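(* The problem $\textsc{Hom}_<$ can be solved in time $n^{\mathcal{O}(c(H))}\cdot h^{\mathcal{O}(1)}$, where $n=|V(G)|$ and $h=|V(H)|$.
   Context: An ordered graph is a (simple) graph whose vertex set is equipped with a total order $\le$. For ordered graphs $G,H$, an ordered homomorphism from $G$ to $H$ is a map $f:V(G)\to V(H)$ such that (1) $uv\in E(G)$ implies $f(u)f(v)\in E(H)$, and (2) $u\le v$ implies $f(u)\le f(v)$. The problem $\textsc{Hom}_<$ is: given ordered graphs $G$ and $H$, decide whether there is an ordered homomorphism from $G$ to $H$. For an ordered graph $H$ with vertices $v_1<\dots<v_h$, let $V_{\le i}=\{v_1,\dots,v_i\}$ and $V_{>i}=\{v_{i+1},\dots,v_h\}$; let $A_i$ be the set of vertices of $V_{\le i}$ having a neighbor in $V_{>i}$, and $B_i$ the set of vertices of $V_{\le i}$ having a non-neighbor in $V_{>i}$. Define $c(H)=\max_i\min(|A_i|,|B_i|)$. *)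

(* Defs.v *)
From mathcomp Require Import all_boot all_order.
Set Implicit Arguments. Unset Strict Implicit. Unset Printing Implicit Defensive.

(* ---------- Ordered graphs ----------
   An ordered graph on n vertices is represented with vertex set 'I_n,
   totally ordered by the natural order of 'I_n (every finite totally
   ordered vertex set is order-isomorphic to such an 'I_n), and a
   symmetric irreflexive adjacency relation. *)

Definition simple_graph (n : nat) (e : rel 'I_n) : Prop :=
  (forall x y, e x y = e y x) /\ (forall x, ~~ e x x).

Definition ord_hom (n h : nat) (eG : rel 'I_n) (eH : rel 'I_h)
  (f : 'I_n -> 'I_h) : Prop :=
  (forall u v, eG u v -> eH (f u) (f v)) /\
  (forall u v : 'I_n, (u <= v)%N -> (f u <= f v)%N).

Definition hom_lt (n h : nat) (eG : rel 'I_n) (eH : rel 'I_h) : Prop :=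
  exists f : 'I_n -> 'I_h, ord_hom eG eH f.

(* A_i, B_i for the split V_{<=i} = {vertices of index < i},
   V_{>i} = {vertices of index >= i} (0-based indices). *)
Definition Aset (h : nat) (eH : rel 'I_h) (i : nat) : {set 'I_h} :=
  [set u : 'I_h | (u < i)%N && [exists v : 'I_h, (i <= v)%N && eH u v]].
Definition Bset (h : nat) (eH : rel 'I_h) (i : nat) : {set 'I_h} :=
  [set u : 'I_h | (u < i)%N && [exists v : 'I_h, (i <= v)%N && ~~ eH u v]].

Definition cH (h : nat) (eH : rel 'I_h) : nat :=
  \max_(i < h.+1) minn #|Aset eH i| #|Bset eH i|.

Inductive instr : Type :=
| IConst (d v : nat)
| IAdd (d a b : nat)
| ISub (d a b : nat)
| ILoad (d a : nat)
| IStore (a s : nat)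
| IJz (r t : nat)
| IHalt.

Record config := Config { pc : nat; mem : nat -> nat }.

Definition upd (m : nat -> nat) (a v : nat) : nat -> nat :=
  fun x => if x == a then v else m x.

Definition halted (P : seq instr) (c : config) : bool :=
  match nth IHalt P (pc c) with IHalt => true | _ => false end.

Definition step (P : seq instr) (c : config) : config :=
  let m := mem c in let p := pc c in
  match nth IHalt P p with
  | IConst d v => Config p.+1 (upd m d v)
  | IAdd d a b => Config p.+1 (upd m d (m a + m b))
  | ISub d a b => Config p.+1 (upd m d (m a - m b))
  | ILoad d a => Config p.+1 (upd m d (m (m a)))
  | IStore a s => Config p.+1 (upd m (m a) (m s))
  | IJz r t => Config (if m r == 0 then t else p.+1) m
  | IHalt => c
  end.

Definition runs_within (P : seq instr) (m0 : nat -> nat) (t : nat)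
  (out : (nat -> nat) -> Prop) : Prop :=
  exists k, k <= t /\ halted P (iter k (step P) (Config 0 m0)) /\
            out (mem (iter k (step P) (Config 0 m0))).

(* Input encoding: R[0] = n, R[1] = h, then the adjacency matrix of G
   (row-major, entries 0/1) at addresses 2 .. 2+n*n-1, then that of H
   at addresses 2+n*n .. 2+n*n+h*h-1; all other registers are 0. *)
Definition adj_bit (k : nat) (e : rel 'I_k) (b : nat) : nat :=
  match insub (b %/ k) , insub (b %% k) with
  | Some i, Some j => nat_of_bool (e i j)
  | _, _ => 0
  end.

Definition encode (n h : nat) (eG : rel 'I_n) (eH : rel 'I_h) (a : nat) : nat :=
  if a == 0 then n else if a == 1 then h else
  let b := a - 2 in
  if b < n * n then adj_bit eG b else
  let c := b - n * n in
  if c < h * h then adj_bit eH c else 0.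

(* Main.v *)
(* Extend a partial homomorphism on the first p vertices of G one vertex at a
   time, in lexicographic order, keeping it monotone.  If x is the last value
   used, the extensions of the map depend only on p, x and on which targets
   v >= x are forbidden for which vertices w by the edges into the first p
   vertices; a search that never expands two maps with the same such key is
   correct.  The number of keys is at most h (n+1)^(2c+2): if A_x is the smaller
   of A_x, B_x, then vertices mapped below x outside A_x forbid every v >= x,
   and if B_x is the smaller, those mapped outside B_x forbid none.  So the key is
   determined by p, x, the first vertex mapped to x, and the intervals of
   vertices mapped to the at most c elements of the smaller set.

   The random access machine is programmed through a small while language.
   Keys are written as numbers in base n+h+2 and used as addresses of the table
   of visited keys, which needs no initialisation. *)

Require Import Defs.
From mathcomp Require Import all_boot all_order.
From mathcomp Require Import zify.
Set Implicit Arguments. Unset Strict Implicit. Unset Printing Implicit Defensive.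

(** * A while language compiled to the machine *)

(* Addresses below [nvar] are program variables, those from [nvar] to [nreg - 1]
   are temporaries, and heap address [a] is machine address [a + nreg]. *)
Definition nvar := 16.
Definition nreg := 26.

Record state := State { var : nat -> nat; heap : nat -> nat }.

Inductive exp : Type :=
| Cst (v : nat) | Var (r : nat)
| Plus (e1 e2 : exp) | Minus (e1 e2 : exp) | Times (e1 e2 : exp)
| Ld (e : exp).

Fixpoint eval (s : state) (e : exp) : nat :=
  match e with
  | Cst v => v
  | Var r => var s r
  | Plus e1 e2 => eval s e1 + eval s e2
  | Minus e1 e2 => eval s e1 - eval s e2
  | Times e1 e2 => eval s e1 * eval s e2
  | Ld e => heap s (eval s e)
  end.

(** Number of machine steps of the compiled expression. The machine has no multiplication, so
    [Times] is repeated addition and its cost grows with the second factor; programs put a small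
    factor there. *)
Fixpoint ecost (s : state) (e : exp) : nat :=
  match e with
  | Cst _ => 1
  | Var _ => 2
  | Plus e1 e2 | Minus e1 e2 => ecost s e1 + ecost s e2 + 1
  | Times e1 e2 => ecost s e1 + ecost s e2 + 5 * eval s e2 + 5
  | Ld e => ecost s e + 3
  end.

Inductive cmd : Type :=
| Skip
| Set_ (r : nat) (e : exp)
| Sto (e1 e2 : exp)
| Seq (c1 c2 : cmd)
| If (e : exp) (c1 c2 : cmd)
| While (e : exp) (c : cmd).

Inductive exec : cmd -> state -> nat -> state -> Prop :=
| ExSkip s : exec Skip s 0 s
| ExSet s r e :
    exec (Set_ r e) s (ecost s e + 2) (State (upd (var s) r (eval s e)) (heap s))
| ExSto s e1 e2 :
    exec (Sto e1 e2) s (ecost s e1 + ecost s e2 + 3)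
         (State (var s) (upd (heap s) (eval s e1) (eval s e2)))
| ExSeq s c1 c2 t1 t2 s1 s2 :
    exec c1 s t1 s1 -> exec c2 s1 t2 s2 -> exec (Seq c1 c2) s (t1 + t2) s2
| ExIfT s e c1 c2 t s1 :
    eval s e != 0 -> exec c1 s t s1 ->
    exec (If e c1 c2) s (ecost s e + t + 3) s1
| ExIfF s e c1 c2 t s1 :
    eval s e = 0 -> exec c2 s t s1 ->
    exec (If e c1 c2) s (ecost s e + t + 1) s1
| ExWhileF s e c :
    eval s e = 0 -> exec (While e c) s (ecost s e + 1) s
| ExWhileT s e c t1 t2 s1 s2 :
    eval s e != 0 -> exec c s t1 s1 -> exec (While e c) s1 t2 s2 ->
    exec (While e c) s (ecost s e + t1 + 3 + t2) s2.

(** The code is placed at [p], since jumps are absolute; it leaves the value in register [d] and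
    uses the registers after [d] as scratch. A register is copied by adding it to zero. *)
Fixpoint compile_exp (p d : nat) (e : exp) : seq instr :=
  match e with
  | Cst v => [:: IConst d v]
  | Var r => [:: IConst d 0; IAdd d d r]
  | Plus e1 e2 =>
      let k1 := compile_exp p d e1 in
      k1 ++ compile_exp (p + size k1) d.+1 e2 ++ [:: IAdd d d d.+1]
  | Minus e1 e2 =>
      let k1 := compile_exp p d e1 in
      k1 ++ compile_exp (p + size k1) d.+1 e2 ++ [:: ISub d d d.+1]
  | Times e1 e2 =>
      let k1 := compile_exp p d e1 in
      let k2 := compile_exp (p + size k1) d.+1 e2 in
      let q := p + size k1 + size k2 in
      k1 ++ k2 ++
      [:: IConst d.+2 0; IConst d.+3 1;
          IJz d.+1 (q + 2 + 5); IAdd d.+2 d.+2 d; ISub d.+1 d.+1 d.+3;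
          IConst d.+4 0; IJz d.+4 (q + 2);
          IConst d.+4 0; IAdd d d.+2 d.+4]
  | Ld e =>
      compile_exp p d e ++ [:: IConst d.+1 nreg; IAdd d d d.+1; ILoad d d]
  end.

Fixpoint compile (p : nat) (c : cmd) : seq instr :=
  match c with
  | Skip => [::]
  | Set_ r e =>
      compile_exp p nvar e ++ [:: IConst nvar.+1 0; IAdd r nvar nvar.+1]
  | Sto e1 e2 =>
      let k1 := compile_exp p nvar e1 in
      k1 ++ compile_exp (p + size k1) nvar.+1 e2 ++
      [:: IConst nvar.+2 nreg; IAdd nvar nvar nvar.+2; IStore nvar nvar.+1]
  | Seq c1 c2 =>
      let k1 := compile p c1 in k1 ++ compile (p + size k1) c2
  | If e c1 c2 =>
      let k := compile_exp p nvar e in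
      let k1 := compile (p + size k + 1) c1 in
      let q := p + size k + 1 + size k1 + 2 in
      let k2 := compile q c2 in
      k ++ [:: IJz nvar q] ++ k1 ++ [:: IConst nvar 0; IJz nvar (q + size k2)] ++ k2
  | While e c =>
      let k := compile_exp p nvar e in
      let k1 := compile (p + size k + 1) c in
      k ++ [:: IJz nvar (p + size k + 1 + size k1 + 2)] ++ k1 ++
      [:: IConst nvar 0; IJz nvar p]
  end.

(** Length of a block of temporaries from [d] on that suffices. A second operand starts one register
    later, and the multiplication loop itself takes five. *)
Fixpoint ntemp (e : exp) : nat :=
  match e with
  | Cst _ | Var _ => 1
  | Plus e1 e2 | Minus e1 e2 => maxn (ntemp e1) (maxn 2 (ntemp e2).+1)
  | Times e1 e2 => maxn (ntemp e1) (maxn (ntemp e2).+1 5)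
  | Ld e => maxn (ntemp e) 2
  end.

Fixpoint vars_ok (e : exp) : bool :=
  match e with
  | Cst _ => true
  | Var r => r < nvar
  | Plus e1 e2 | Minus e1 e2 | Times e1 e2 => vars_ok e1 && vars_ok e2
  | Ld e => vars_ok e
  end.

Definition exp_ok (k : nat) (e : exp) : bool :=
  vars_ok e && (nvar + k + ntemp e <= nreg).

Fixpoint cmd_ok (c : cmd) : bool :=
  match c with
  | Skip => true
  | Set_ r e => (r < nvar) && exp_ok 0 e
  | Sto e1 e2 => exp_ok 0 e1 && exp_ok 1 e2
  | Seq c1 c2 => cmd_ok c1 && cmd_ok c2
  | If e c1 c2 => [&& exp_ok 0 e, cmd_ok c1 & cmd_ok c2]
  | While e c => exp_ok 0 e && cmd_ok c
  end.

(** * Execution of compiled code *)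

Definition code_at (P : seq instr) (p : nat) (k : seq instr) : Prop :=
  forall j, j < size k -> nth IHalt P (p + j) = nth IHalt k j.

Lemma code_at_cat P p k1 k2 :
  code_at P p (k1 ++ k2) <-> code_at P p k1 /\ code_at P (p + size k1) k2.
Proof.
split=> [H | [H1 H2] j].
  split=> j lt_j.
    by rewrite H ?nth_cat ?lt_j // size_cat ltn_addr.
  by rewrite -addnA H ?nth_cat ?size_cat ?ltn_add2l // ltnNge leq_addr addKn.
rewrite size_cat nth_cat; case: (ltnP j (size k1)) => [lt_j _|le_j lt_j]; first exact: H1.
by rewrite -H2 -?addnA ?subnKC // ltn_subLR.
Qed.

Lemma code_at_cons P p i k :
  code_at P p (i :: k) <-> nth IHalt P p = i /\ code_at P p.+1 k.
Proof.
rewrite -cat1s code_at_cat addn1; split=> -[H1 H2]; split=> //.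
  by have := H1 0 isT; rewrite addn0.
by case=> // _; rewrite addn0.
Qed.

Definition reach P k c c' := iter k (step P) c = c'.

Lemma reach_trans P k1 k2 c1 c2 c3 :
  reach P k1 c1 c2 -> reach P k2 c2 c3 -> reach P (k1 + k2) c1 c3.
Proof. by rewrite /reach addnC iterD => -> ->. Qed.

Lemma reach1 P p m c : step P (Config p m) = c -> reach P 1 (Config p m) c.
Proof. by []. Qed.

Lemma upd_eq m a v : upd m a v a = v.
Proof. by rewrite /upd eqxx. Qed.

Lemma upd_neq m a v b : b != a -> upd m a v b = m b.
Proof. by rewrite /upd => /negbTE ->. Qed.

Definition represents (s : state) (m : nat -> nat) : Prop :=
  (forall r, r < nvar -> m r = var s r) /\ (forall a, m (a + nreg) = heap s a).

(** Keeping the registers below [d] protects the program variables and the operands already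
    evaluated; keeping the addresses from [nreg] on protects the heap. *)
Definition frame (d : nat) (m m' : nat -> nat) : Prop :=
  forall a, (a < d) || (nreg <= a) -> m' a = m a.

Lemma represents_frame s m m' d :
  nvar <= d -> frame d m m' -> represents s m -> represents s m'.
Proof.
move=> le_d F [R1 R2]; split=> [r lt_r|a].
  by rewrite F ?R1 // (leq_trans lt_r le_d).
by rewrite F ?R2 // leq_addl orbT.
Qed.

Lemma frame_trans d d' m1 m2 m3 :
  d <= d' -> frame d m1 m2 -> frame d' m2 m3 -> frame d m1 m3.
Proof.
move=> le_d F1 F2 a /orP[lt_a|le_a].
  by rewrite F2 ?F1 ?lt_a // (leq_trans lt_a le_d).
by rewrite F2 ?F1 ?le_a ?orbT.
Qed.

Lemma frame_upd d m a v : d <= a < nreg -> frame d m (upd m a v).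
Proof. by move=> lim b lim'; rewrite upd_neq //; apply/eqP; lia. Qed.

Definition jump_free (i : instr) : bool :=
  match i with IJz _ _ | IHalt => false | _ => true end.

Definition act (m : nat -> nat) (i : instr) : nat -> nat :=
  match i with
  | IConst d v => upd m d v
  | IAdd d a b => upd m d (m a + m b)
  | ISub d a b => upd m d (m a - m b)
  | ILoad d a => upd m d (m (m a))
  | IStore a s => upd m (m a) (m s)
  | IJz _ _ | IHalt => m
  end.

Lemma straight_line P p k m :
  code_at P p k -> all jump_free k ->
  reach P (size k) (Config p m) (Config (p + size k) (foldl act m k)).
Proof.
elim: k p m => [|i k IH] p m; first by rewrite /reach /= addn0.
rewrite code_at_cons => -[Pi Pk] /= /andP[ji jk].
rewrite addnS -addSn /= -[X in reach _ X]add1n.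
apply: reach_trans (IH _ _ Pk jk); apply: reach1; rewrite /step /= Pi.
by case: i ji {Pi}.
Qed.

Ltac supd :=
  repeat first [rewrite upd_eq | rewrite upd_neq; [|by apply/eqP; lia]].

(** Register [d.+2] accumulates, [d.+1] counts down, [d.+3] holds the decrement 1, and [d.+4] is
    zeroed to make the backward jump unconditional. Each round takes five steps, the final test
    one. *)
Lemma mul_loop P q d m v :
  code_at P q
    [:: IJz d.+1 (q + 5); IAdd d.+2 d.+2 d; ISub d.+1 d.+1 d.+3;
        IConst d.+4 0; IJz d.+4 q] ->
  m d.+1 = v -> m d.+3 = 1 -> d.+4 < nreg ->
  exists m', [/\ reach P (5 * v + 1) (Config q m) (Config (q + 5) m'),
    m' d.+2 = m d.+2 + m d * v & frame d.+1 m m'].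
Proof.
move=> code; move: (code).
rewrite code_at_cons (code_at_cat _ _ [:: _; _; _]) => -[i0 [body]].
rewrite code_at_cons => -[i4 _].
elim: v m => [|v IH] m mv m1 lim.
  exists m; split=> //; last by rewrite muln0 addn0.
  by apply: reach1; rewrite /step /= i0 mv.
have B := straight_line m body isT.
set m1' := foldl _ _ _ in B.
have mv' : m1' d.+1 = v by rewrite /m1' /=; supd; rewrite mv m1 subn1.
have m1'1 : m1' d.+3 = 1 by rewrite /m1' /=; supd.
have [m' [R E F]] := IH m1' mv' m1'1 lim.
exists m'; split.
- rewrite mulnS -addnA; apply: reach_trans R.
  apply: (@reach_trans _ 1 4); first by apply: reach1; rewrite /step /= i0 mv.
  apply: (@reach_trans _ 3 1) B _; apply: reach1.
  by rewrite /step /= i4 /m1' /= upd_eq eqxx.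
- by rewrite E /m1' /=; supd; lia.
- apply: frame_trans F => //.
  by move=> a lim'; rewrite /m1' /=; supd.
Qed.

Lemma compile_expP P e s m p d :
  code_at P p (compile_exp p d e) -> represents s m -> vars_ok e ->
  nvar <= d -> d + ntemp e <= nreg ->
  exists m', [/\ reach P (ecost s e) (Config p m)
                       (Config (p + size (compile_exp p d e)) m'),
    m' d = eval s e & frame d m m'].
Proof.
elim: e p d m => [v|r|e1 IH1 e2 IH2|e1 IH1 e2 IH2|e1 IH1 e2 IH2|e IH] p d m /=.
- move=> H _ _ led lim; exists (upd m d v); rewrite upd_eq; split=> //.
    exact: (straight_line m H).
  by apply: frame_upd; lia.
- move=> H [R1 _] okr led lim.
  have S := straight_line m H isT.
  eexists; split; first exact: S.
    by rewrite /=; supd; rewrite R1.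
  by move=> a lim' /=; supd.
- rewrite !code_at_cat => -[H1 [H2 H3]] R /andP[ok1 ok2] led lim.
  have [|m1 [X1 E1 F1]] := IH1 _ _ _ H1 R ok1 led; first by lia.
  have R1 := represents_frame led F1 R.
  have [||m2 [X2 E2 F2]] := IH2 _ _ _ H2 R1 ok2; try lia.
  have S := straight_line m2 H3 isT.
  eexists; split.
  + rewrite !size_cat !addnA.
    apply: reach_trans; last exact: S.
    exact: reach_trans X1 X2.
  + by rewrite /= upd_eq E2 F2 ?E1 // leqnn.
  + by move=> a lim' /=; rewrite upd_neq ?F2 ?F1 //; [|apply/eqP]; lia.
- rewrite !code_at_cat => -[H1 [H2 H3]] R /andP[ok1 ok2] led lim.
  have [|m1 [X1 E1 F1]] := IH1 _ _ _ H1 R ok1 led; first by lia.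
  have R1 := represents_frame led F1 R.
  have [||m2 [X2 E2 F2]] := IH2 _ _ _ H2 R1 ok2; try lia.
  have S := straight_line m2 H3 isT.
  eexists; split.
  + rewrite !size_cat !addnA.
    apply: reach_trans; last exact: S.
    exact: reach_trans X1 X2.
  + by rewrite /= upd_eq E2 F2 ?E1 // leqnn.
  + by move=> a lim' /=; rewrite upd_neq ?F2 ?F1 //; [|apply/eqP]; lia.
- set q := p + _ + _.
  rewrite !code_at_cat -/q => -[H1 [H2]].
  rewrite (code_at_cat _ _ [:: _; _]) (code_at_cat _ _ [:: _; _; _; _; _] [:: _; _]).
  move=> [H3 [H4 H5]] R /andP[ok1 ok2] led lim.
  have [|m1 [X1 E1 F1]] := IH1 _ _ _ H1 R ok1 led; first by lia.
  have R1 := represents_frame led F1 R.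
  have [||m2 [X2 E2 F2]] := IH2 _ _ _ H2 R1 ok2; try lia.
  have S := straight_line m2 H3 isT.
  set m3 := foldl _ _ _ in S; rewrite /= -/q in S.
  rewrite /= -/q in H4; 
  have m3v : m3 d.+1 = eval s e2 by rewrite /m3 /=; supd.
  have m31 : m3 d.+3 = 1 by rewrite /m3 /=; supd.
  have [|m4 [X4 E4 F4]] := mul_loop H4 m3v m31; first by lia.
  rewrite /= -/q in H5; have S5 := straight_line m4 H5 isT.
  eexists; split.
  + rewrite !size_cat !addnA -/q.
    rewrite (_ : _ + _ + 5 = ecost s e1 + ecost s e2 + 2 + (5 * eval s e2 + 1) + 2);
      last by lia.
    rewrite (_ : q + _ = q + 2 + 5 + 2); last by rewrite /=; lia.
    apply: reach_trans; last exact: S5.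
    apply: reach_trans; last exact: X4.
    apply: reach_trans; last exact: S.
    exact: reach_trans X1 X2.
  + rewrite /= upd_eq; supd; rewrite E4 /m3 /=; supd.
    by rewrite F2 ?E1 ?ltnSn // add0n addn0.
  + move=> a lim' /=; supd; rewrite F4; last by lia.
    by rewrite /m3 /=; supd; rewrite F2 ?F1 //; lia.
- rewrite !code_at_cat => -[H1 H2] R ok led lim.
  have [|m1 [X1 E1 F1]] := IH _ _ _ H1 R ok led; first by lia.
  have [_ R2] := represents_frame led F1 R.
  have S := straight_line m1 H2 isT.
  eexists; split.
  + by rewrite !size_cat !addnA; apply: reach_trans X1 _; exact: S.
  + by rewrite /=; supd; rewrite E1 R2.
  + by move=> a lim' /=; supd; rewrite F1.
Qed.

Lemma compile_exp0P P e s m p :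
  code_at P p (compile_exp p nvar e) -> represents s m -> exp_ok 0 e ->
  exists m', [/\ reach P (ecost s e) (Config p m)
                       (Config (p + size (compile_exp p nvar e)) m'),
    m' nvar = eval s e & represents s m'].
Proof.
move=> H R /andP[ok lim].
have [|m1 [X1 E1 F1]] := compile_expP H R ok (leqnn _); first by lia.
by exists m1; split=> //; apply: represents_frame F1 R.
Qed.

Lemma represents_upd_temp s m a v :
  nvar <= a < nreg -> represents s m -> represents s (upd m a v).
Proof. by move=> lim; apply: represents_frame (leqnn _) _; apply: frame_upd. Qed.

Lemma goto P p t m :
  code_at P p [:: IConst nvar 0; IJz nvar t] ->
  reach P 2 (Config p m) (Config t (upd m nvar 0)).
Proof.
rewrite !code_at_cons => -[i0 [i1 _]].
by rewrite /reach /= {2}/step i0 /step /= i1 upd_eq.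
Qed.

Lemma compile_If p e c1 c2 :
  compile p (If e c1 c2) =
  let k := compile_exp p nvar e in
  let k1 := compile (p + size k + 1) c1 in
  let q := p + size k + 1 + size k1 + 2 in
  let k2 := compile q c2 in
  k ++ [:: IJz nvar q] ++ k1 ++ [:: IConst nvar 0; IJz nvar (q + size k2)] ++ k2.
Proof. by []. Qed.

Lemma compile_While p e c :
  compile p (While e c) =
  let k := compile_exp p nvar e in
  let k1 := compile (p + size k + 1) c in
  k ++ [:: IJz nvar (p + size k + 1 + size k1 + 2)] ++ k1 ++
  [:: IConst nvar 0; IJz nvar p].
Proof. by []. Qed.

Lemma compileP P c s t s' p m :
  exec c s t s' -> cmd_ok c -> code_at P p (compile p c) -> represents s m ->
  exists2 m', reach P t (Config p m) (Config (p + size (compile p c)) m') & represents s' m'.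
Proof.
move=> X; elim: X p m => {c s t s'}.
- by move=> s p m _ _ R; exists m => //; rewrite /reach /= addn0.
- move=> s r e p m /= /andP[okr oke]; rewrite code_at_cat => -[H1 H2] R.
  have [m1 [X1 E1 [R1 R2]]] := compile_exp0P H1 R oke.
  have S := straight_line m1 H2 isT.
  eexists.
    by rewrite size_cat addnA; apply: reach_trans X1 _; exact: S.
  rewrite /=; split=> [r' lt_r'|a] /=; last first.
    by rewrite upd_neq ?upd_neq ?R2 //; apply/eqP; rewrite /nvar /nreg in okr *; lia.
  rewrite /upd; case: (r' =P r) => [_|ne]; last first.
    by rewrite (_ : (r' == nvar.+1) = false) ?R1 //; apply/eqP; lia.
  by rewrite eqxx eqn_leq ltnn andbF E1 addn0.
- move=> s e1 e2 p m /= /andP[ok1 ok2]; rewrite !code_at_cat => -[H1 [H2 H3]] R.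
  have [m1 [X1 E1 R1]] := compile_exp0P H1 R ok1.
  case/andP: ok2 => ok2 lim; rewrite addn1 in lim.
  have [m2 [X2 E2 F2]] := compile_expP H2 R1 ok2 (leqnSn _) lim.
  have R2 := represents_frame (leqnSn _) F2 R1.
  have S := straight_line m2 H3 isT.
  eexists.
    rewrite !size_cat !addnA.
    by apply: reach_trans S; apply: reach_trans X1 X2.
  rewrite /=; supd; rewrite E2 F2 ?ltnSn // E1.
  case: R2 => R2 R3; split=> [r lt_r|a] /=.
    rewrite upd_neq; last by apply/eqP; rewrite /nvar /nreg in lt_r *; lia.
    by rewrite !upd_neq ?R2 //; apply/eqP; lia.
  rewrite /upd eqn_add2r; case: (a =P _) => // _.
  rewrite (_ : (a + nreg == nvar) = false); last by apply/eqP; rewrite /nvar /nreg; lia.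
  rewrite (_ : (a + nreg == nvar.+2) = false) ?R3 //; apply/eqP; rewrite /nvar /nreg; lia.
- move=> s c1 c2 t1 t2 s1 s2 _ IH1 _ IH2 p m /= /andP[ok1 ok2].
  rewrite code_at_cat => -[H1 H2] R.
  have [m1 X1 R1] := IH1 _ _ ok1 H1 R.
  have [m2 X2 R2] := IH2 _ _ ok2 H2 R1.
  by exists m2 => //; rewrite size_cat addnA; apply: reach_trans X1 X2.
- move=> s e c1 c2 t s1 ne _ IH p m ok; case/and3P: (ok) => oke ok1 ok2.
  rewrite compile_If; cbv zeta; rewrite !code_at_cat => -[H1 [H2 [H3 [H4 H5]]]] R.
  have [m1 [X1 E1 R1]] := compile_exp0P H1 R oke.
  have [m2 X2 R2] := IH _ _ ok1 H3 R1.
  exists (upd m2 nvar 0); last exact: represents_upd_temp.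
  have X3 := goto m2 H4.
  rewrite !size_cat !addnA (_ : ecost s e + t + 3 = ecost s e + 1 + t + 2); last by lia.
  apply: reach_trans X3; apply: reach_trans X2; apply: reach_trans X1 _.
  move/code_at_cons: H2 => -[i0 _]; apply: reach1.
  by rewrite /step i0 /= E1 (negbTE ne) addn1.
- move=> s e c1 c2 t s1 ez _ IH p m ok; case/and3P: (ok) => oke ok1 ok2.
  rewrite compile_If; cbv zeta; rewrite !code_at_cat => -[H1 [H2 [H3 [H4 H5]]]] R.
  have [m1 [X1 E1 R1]] := compile_exp0P H1 R oke.
  have [m2 X2 R2] := IH _ _ ok2 H5 R1.
  exists m2 => //.
  rewrite !size_cat !addnA addnAC; apply: reach_trans X2.
  apply: reach_trans X1 _.
  move/code_at_cons: H2 => -[i0 _]; apply: reach1.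
  by rewrite /step i0 /= E1 ez eqxx.
- move=> s e c ez p m ok; case/andP: (ok) => oke okc.
  rewrite compile_While; cbv zeta; rewrite !code_at_cat => -[H1 [H2 _]] R.
  have [m1 [X1 E1 R1]] := compile_exp0P H1 R oke.
  exists m1 => //.
  rewrite !size_cat !addnA; apply: reach_trans X1 _.
  move/code_at_cons: H2 => -[i0 _]; apply: reach1.
  by rewrite /step i0 /= E1 ez eqxx.
- move=> s e c t1 t2 s1 s2 ne _ IH1 _ IH2 p m ok.
  have /andP[oke okc] := ok.
  move=> H R; have := H; rewrite compile_While; cbv zeta.
  rewrite !code_at_cat => -[H1 [H2 [H3 H4]]].
  have [m1 [X1 E1 R1]] := compile_exp0P H1 R oke.
  have [m2 X2 R2] := IH1 _ _ okc H3 R1.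
  have X3 := goto m2 H4.
  have R3 : represents s1 (upd m2 nvar 0) by apply: represents_upd_temp.
  (* The jump returns to [p], where the code of the whole loop stands, so the hypothesis for the
     remaining rounds applies to the same [H]. *)
  have [m3 X4 R4] := IH2 _ _ ok H R3.
  exists m3 => //.
  rewrite (_ : ecost s e + t1 + 3 + t2 = ecost s e + 1 + t1 + 2 + t2); last by lia.
  apply: reach_trans X4; apply: reach_trans X3; apply: reach_trans X2.
  apply: reach_trans X1 _.
  move/code_at_cons: H2 => -[i0 _]; apply: reach1.
  by rewrite /step i0 /= E1 (negbTE ne) addn1.
Qed.

(** * The depth-first search *)

Definition horner (B k : nat) (l : seq nat) : nat :=
  foldl (fun k d => k * B + d) k l.

(** Division by [B] strips one digit at a time, so the leading parts may be arbitrarily large. *)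
Lemma horner_inj B k1 k2 l1 l2 :
  size l1 = size l2 -> all (gtn B) l1 -> all (gtn B) l2 ->
  horner B k1 l1 = horner B k2 l2 -> k1 = k2 /\ l1 = l2.
Proof.
elim: l1 l2 k1 k2 => [|d1 l1 IH] [|d2 l2] //= k1 k2 [sz] /andP[lt1 a1] /andP[lt2 a2].
move=> /(IH _ _ _ sz a1 a2) [E ->].
have B0 : 0 < B by apply: leq_ltn_trans lt1.
have Ek : k1 = k2.
  by move/(congr1 (divn^~ B)): E; rewrite !divnMDl // !divn_small // !addn0.
by move: E; rewrite Ek => /addnI ->.
Qed.

(** With [k] the start of the table, this keeps every key, used as an address, clear of the data
    stored below. *)
Lemma horner_ge B k l : 0 < B -> k <= horner B k l.
Proof.
move=> B0; elim: l k => //= d l IH k.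
by apply: leq_trans (IH _); rewrite (leq_trans (leq_pmulr k B0)) // leq_addr.
Qed.

Section OrderedHom.

Variables (n h : nat) (G H : rel nat).

Definition good (q : nat) (f : nat -> nat) : Prop :=
  [/\ forall u, u < q -> f u < h,
      forall u v, u <= v -> v < q -> f u <= f v &
      forall u w, u < w -> w < q -> G u w -> H (f u) (f w)].

Definition dead (q : nat) (f : nat -> nat) : Prop :=
  forall g, good n g -> ~ (forall u, u < q -> g u = f u).

Definition forb (q : nat) (f : nat -> nat) (w v : nat) : bool :=
  has (fun u => G u w && ~~ H (f u) v) (iota 0 q).

(* Only targets [v >= x] matter for extensions; smaller [v] repeat the digit of
   [x], which keeps the number of digits fixed. *)
Definition digits (q : nat) (f : nat -> nat) (x : nat) : seq nat :=
  q :: x :: [seq (forb q f wv.1 (maxn wv.2 x) : nat)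
            | wv <- [seq (w, v) | w <- iota 0 n, v <- iota 0 h]].

Variable base : nat.

Definition skey (q : nat) (f : nat -> nat) (x : nat) : nat :=
  horner (n + h + 2) base (digits q f x).

Lemma forbP q f w v :
  reflect (exists u, [/\ u < q, G u w & ~~ H (f u) v]) (forb q f w v).
Proof.
apply: (iffP hasP) => [[u]|[u [lt_u Guw nH]]].
  by rewrite mem_iota => /= lt_u /andP[]; exists u.
by exists u; rewrite ?mem_iota ?Guw.
Qed.

Lemma forbS q f w v :
  forb q.+1 f w v = forb q f w v || G q w && ~~ H (f q) v.
Proof. by rewrite /forb -addn1 iotaD has_cat /= orbF. Qed.

Lemma good_eq q f g : (forall u, u < q -> f u = g u) -> good q f -> good q g.
Proof.
move=> E [F1 F2 F3]; split=> [u lt_u|u v le_uv lt_v|u w lt_uw lt_w].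
- by rewrite -E ?F1.
- by rewrite -!E ?F2 // (leq_ltn_trans le_uv).
- by rewrite -!E ?(ltn_trans lt_uw) //; apply: F3.
Qed.

Lemma good_le q r f : q <= r -> good r f -> good q f.
Proof.
move=> le [F1 F2 F3]; split=> [u lt_u|u v le_uv lt_v|u w lt_uw lt_w].
- by rewrite F1 // (leq_trans lt_u).
- by rewrite F2 // (leq_trans lt_v).
- by apply: F3 => //; rewrite (leq_trans lt_w).
Qed.

Lemma good_extend p f :
  good p f -> f p < h -> (0 < p -> f p.-1 <= f p) -> ~~ forb p f p (f p) ->
  good p.+1 f.
Proof.
move=> [F1 F2 F3] lt_fp le_fp nf; split=> [u|u v le_uv|u w lt_uw].
- by rewrite ltnS leq_eqVlt => /predU1P[->//|/F1].
- rewrite ltnS leq_eqVlt => /predU1P[Ev|lt_v]; last exact: F2.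
  move: le_uv; rewrite Ev leq_eqVlt => /predU1P[->//|lt_u].
  by apply: leq_trans (le_fp _); first apply: F2; lia.
- rewrite ltnS leq_eqVlt => /predU1P[Ew|lt_w]; last exact: F3.
  move: lt_uw; rewrite Ew => lt_u Gup; apply: contraR nf => nH.
  by apply/forbP; exists u.
Qed.

Lemma forb_dead p f : p < n -> forb p f p (f p) -> dead p.+1 f.
Proof.
move=> lt_p /forbP[u [lt_u Gu /negP nH]] g [_ _ g3] E; case: nH.
by rewrite -(E u (ltnW lt_u)) -(E p (ltnSn p)); apply: g3.
Qed.

(* Two partial maps with the same last value and the same forbidden targets
   have the same extensions, so one may be replaced by the other. *)
Lemma dead_exchange p f g :
  good p.+1 f -> good p.+1 g -> f p = g p ->
  (forall w v, w < n -> f p <= v -> v < h -> forb p.+1 f w v = forb p.+1 g w v) ->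
  dead p.+1 g -> dead p.+1 f.
Proof.
move=> [f1 f2 f3] [g1 g2 g3] E Eforb D k [k1 k2 k3] Ek.
(* Graft the part after [p] of an extension [k] of [f] onto [g]. *)
pose k' u := if u <= p then g u else k u.
apply: (D k') => [|u]; last by rewrite /k' ltnS => ->.
split=> [u lt_u|u v le_uv lt_v|u w lt_uw lt_w]; rewrite /k'.
- by case: ifP => [le_u|_]; [apply: g1 | apply: k1].
- case: ifP => [le_u|gt_u]; case: ifP => [le_v|gt_v].
  + exact: g2.
  + have [lt_p] : p < v by lia.
    by apply: leq_trans (g2 _ _ le_u (ltnSn p)) _; rewrite -E -Ek // k2 // ltnW.
  + by lia.
  + exact: k2.
- case: ifP => [le_u|gt_u]; case: ifP => [le_w|gt_w] Guw.
  + exact: g3.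
  + have lt_p : p < w by lia.
    (* An edge across [p]: if [g u] and [k w] were not adjacent, [k w] would be forbidden for [w]
       under [g], hence under [f], although [k] extends [f]. Equality of the forbidden sets applies
       because [f p <= k w]. *)
    have le_k : f p <= k w by rewrite -Ek // k2 // ltnW.
    apply/negPn/negP => nH.
    have : forb p.+1 f w (k w) by rewrite Eforb ?k1 //; apply/forbP; exists u.
    case/forbP=> u' [lt_u' Gu' /negP[]].
    by rewrite -Ek //; apply: k3 => //; apply: leq_ltn_trans lt_p.
  + by lia.
  + exact: k3.
Qed.

Lemma skey_inj q f x r g y :
  q <= n -> r <= n -> x < h -> y < h -> skey q f x = skey r g y ->
  [/\ q = r, x = y &
    forall w v, w < n -> x <= v -> v < h -> forb q f w v = forb r g w v].
Proof.
move=> le_q le_r lt_x lt_y /horner_inj[]; rewrite /= ?size_map //.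
(* All digits are below the base [n + h + 2]: the first is at most [n], the second is below [h], the
   others are bits. *)
- rewrite !(leq_ltn_trans le_q) ?(ltn_trans lt_x) ?all_map //=; try lia.
  by apply/allP=> wv _ /=; case: forb => //=; lia.
- rewrite !(leq_ltn_trans le_r) ?(ltn_trans lt_y) ?all_map //=; try lia.
  by apply/allP=> wv _ /=; case: forb => //=; lia.
move=> _ [Eq Ex /eq_in_map E]; split=> // w v lt_w le_v lt_v.
have /E /= : (w, v) \in [seq (w, v) | w <- iota 0 n, v <- iota 0 h].
  by apply/allpairsP; exists (w, v); rewrite !mem_iota.
rewrite -Ex (maxn_idPl le_v).
by do 2 case: forb.
Qed.

(** * Counting the keys *)

Definition cut (q : nat) (f : nat -> nat) (a : nat) : nat :=
  find (fun u => a <= f u) (iota 0 q).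

Lemma cut_le q f a : cut q f a <= q.
Proof. by rewrite -[X in _ <= X](size_iota 0) find_size. Qed.

(** By monotonicity the vertices mapped below [a] form an initial segment of length [cut q f a];
    hence the fibre over [a] is the interval from [cut q f a] to [cut q f a.+1], the right end
    excluded. *)
Lemma cutP q f a u :
  (forall u v, u <= v -> v < q -> f u <= f v) -> u < q ->
  (u < cut q f a) = (f u < a).
Proof.
move=> f2 lt_u; case: ltnP => [lt_c|le_c].
  have := before_find 0 lt_c.
  by rewrite nth_iota // add0n => /negbT; rewrite -ltnNge => ->.
apply/esym/negbTE; rewrite -leqNgt; apply: leq_trans (f2 _ _ le_c lt_u).
have lt_c : cut q f a < q by apply: leq_ltn_trans lt_u.
have := @nth_find _ 0 (fun u => a <= f u) (iota 0 q).
by rewrite has_find size_iota nth_iota // => ->.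
Qed.

Section Count.

(* For a cut of H before its vertex [x], the vertices of [S x] are those whose
   fibres must be remembered; all other vertices to the left of the cut relate
   in the same way, [tt x], to everything on the right. *)
Variables (c : nat) (S : nat -> seq nat) (tt : nat -> bool).
Hypothesis S_size : forall x, x < h -> size (S x) <= c.
Hypothesis S_out : forall x a v,
  a < x -> a \notin S x -> x <= v -> v < h -> H a v = tt x.

(** The number of mapped vertices, the last value [x], the first vertex mapped to [x], and the ends
    of the fibres over the elements of [S x], padded to [c] entries. *)
Definition code : Type :=
  ('I_n.+1 * 'I_h * 'I_n.+1 * {ffun 'I_c -> 'I_n.+1 * 'I_n.+1})%type.

(** Recomputes [forb] without the map: [u] goes to [x] from [ci] on, to an element of [S x] if it
    lies in the corresponding interval, and otherwise to a vertex whose adjacency to the right is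
    [tt x]. The test on [size (S x)] skips the padding. *)
Definition code_forb (t : code) (w v : nat) : bool :=
  let: (q, x, ci, t) := t in
  has (fun u => G u w &&
    ~~ (if ci <= u then H x v
        else if [pick j : 'I_c | (j < size (S x)) && ((t j).1 <= u < (t j).2)]
             is Some j then H (nth 0 (S x) j) v else tt x)) (iota 0 q).

Definition code_key (t : code) : nat :=
  horner (n + h + 2) base
    ((t.1.1.1 : nat) :: (t.1.1.2 : nat) ::
     [seq (code_forb t wv.1 (maxn wv.2 t.1.1.2) : nat)
     | wv <- [seq (w, v) | w <- iota 0 n, v <- iota 0 h]]).

Lemma skey_code p f :
  p < n -> good p.+1 f -> exists t, skey p.+1 f (f p) = code_key t.
Proof.
move=> lt_p [f1 f2 f3].
have lt_x : f p < h by apply: f1.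
have lt_cut a : cut p.+1 f a < n.+1 by rewrite ltnS (leq_trans (cut_le _ _ _)).
pose t : {ffun 'I_c -> 'I_n.+1 * 'I_n.+1} :=
  [ffun j : 'I_c => (Ordinal (lt_cut (nth 0 (S (f p)) j)),
                     Ordinal (lt_cut (nth 0 (S (f p)) j).+1))].
exists (Ordinal (lt_p : p.+1 < n.+1), Ordinal lt_x, Ordinal (lt_cut (f p)), t).
congr (horner _ _ (_ :: _ :: _)); apply/eq_in_map => -[w v] /allpairsP[[w' v'] /=].
rewrite !mem_iota => -[lt_w lt_v [-> ->]] {w v}; congr nat_of_bool.
apply/eq_in_has => u; rewrite mem_iota => lt_u; congr (_ && ~~ _).
have lt_m : maxn v' (f p) < h by rewrite gtn_max lt_x andbT.
rewrite leqNgt cutP //=.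
have le_fu : f u <= f p by apply: f2.
case: ltnP => [lt_fu|ge_fu]; last by rewrite (_ : f u = f p) //; lia.
case: pickP => [j /andP[lt_j]|no].
  by rewrite /t ffunE /= leqNgt !cutP //; move=> lim; congr (H _ _); lia.
apply: S_out => //; last by rewrite leq_maxr.
(* If [f u] were in [S x], its own index would have been found by the search for an interval
   containing [u]. *)
apply/negP=> Sfu; have lt_i : index (f u) (S (f p)) < c.
  by apply: leq_trans (S_size lt_x); rewrite index_mem.
have := no (Ordinal lt_i); rewrite /= index_mem Sfu /t ffunE /=.
by rewrite leqNgt !cutP // nth_index //; lia.
Qed.

Definition key_bound : nat := n.+1 * h * n.+1 * (n.+1 * n.+1) ^ c.

Lemma size_keys (V : seq nat) :
  uniq V ->
  (forall k, k \in V ->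
     exists p f, [/\ p < n, good p.+1 f & k = skey p.+1 f (f p)]) ->
  size V <= key_bound.
Proof.
move=> uV allV.
have -> : key_bound = size [seq code_key t | t <- enum {: code}].
  by rewrite size_map -cardE !card_prod card_ffun !card_ord card_prod !card_ord.
apply: uniq_leq_size => // k /allV[p [f [lt_p gf ->]]].
have [t ->] := skey_code lt_p gf.
by apply: map_f; rewrite mem_enum.
Qed.

(* The first [p] vertices are mapped by [f], and [f p] is the next candidate for
   vertex [p].  A visited key belongs to a dead map or to a prefix of [f]; by the
   last clause no solution is lexicographically smaller than [f]. *)
Definition search_inv (p : nat) (f : nat -> nat) (V : seq nat) : Prop :=
  [/\ [/\ p <= n, good p f, f p <= h & 0 < p -> f p.-1 <= f p],
      uniq V,
      forall k, k \in V -> exists q g,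
        [/\ q < n, good q.+1 g, k = skey q.+1 g (g q) &
            dead q.+1 g \/ (q < p /\ forall u, u <= q -> g u = f u)] &
      forall q g, good n g -> q <= p -> q < n ->
        (forall u, u < q -> g u = f u) -> f q <= g q].

(* Each new key pays for the at most [h + 1] candidates of the level it opens. *)
Definition potential (p : nat) (f : nat -> nat) (V : seq nat) : nat :=
  (key_bound - size V) * (h + 2) + \sum_(q < p.+1) (h.+1 - f q).

(** * The moves of the search preserve the invariant *)

Lemma search_fail f V :
  search_inv 0 f V -> f 0 = h -> 0 < n -> forall g, ~ good n g.
Proof.
move=> [_ _ _ lexi] f0 n0 g gg; have : f 0 <= g 0 by apply: lexi.
by case: gg => g1 _ _; rewrite f0 leqNgt g1.
Qed.

Lemma search_size p f V : search_inv p f V -> size V <= key_bound.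
Proof.
move=> [_ uV allV _]; apply: size_keys => // k /allV[q [g [lt_q gg Ek _]]].
by exists q, g.
Qed.

Lemma potential_next p f V :
  f p <= h -> potential p (upd f p (f p).+1) V < potential p f V.
Proof.
move=> le_f; rewrite /potential ltn_add2l !big_ord_recr /= /upd eqxx.
rewrite (eq_bigr (fun i : 'I_p => h.+1 - f i)); first by lia.
by move=> i _; rewrite ltn_eqF.
Qed.

Lemma search_next p f V :
  search_inv p f V -> p < n -> f p < h -> dead p.+1 f ->
  search_inv p (upd f p (f p).+1) V.
Proof.
move=> [[le_p gf le_f le_fp] uV allV lexi] lt_p lt_f df.
have E u : u < p -> upd f p (f p).+1 u = f u by move=> lt_u; rewrite upd_neq ?ltn_eqF.
split=> //.
- split=> //; rewrite ?upd_eq //; first by apply: good_eq gf => u /E.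
  by move=> p0; rewrite E ?ltn_predL // leqW // le_fp.
- move=> k /allV[q [g [lt_q gg Ek D]]]; exists q, g; split=> //.
  case: D => [|[lt_qp D]]; [by left | right; split=> // u le_u].
  by rewrite E ?D // (leq_ltn_trans le_u).
- move=> q g gg le_q lt_q Eg.
  have Eg' u : u < q -> g u = f u.
    by move=> lt_u; rewrite Eg // E // (leq_trans lt_u).
  have := lexi q g gg le_q lt_q Eg'.
  move: le_q; rewrite leq_eqVlt => /predU1P[Eq|lt_qp]; last by rewrite E.
  (* A solution with this prefix takes at least [f p] at [p]; equality would make it extend the dead
     map. *)
  rewrite Eq upd_eq leq_eqVlt => /predU1P[Efg|//]; case: (df g gg) => u.
  by rewrite ltnS leq_eqVlt => /predU1P[->//|]; rewrite -Eq; apply: Eg'.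
Qed.

(** When the candidates for [p.+1] are exhausted, the lexicographic clause would force any extension
    to take a value at least [h] there. So the map on the first [p.+1] vertices is dead, and the
    candidate at [p] can be advanced. *)
Lemma search_pop p f V :
  search_inv p.+1 f V -> p.+1 < n -> f p.+1 = h ->
  search_inv p (upd f p (f p).+1) V /\
  potential p (upd f p (f p).+1) V < potential p.+1 f V.
Proof.
move=> [[le_p gf le_f le_fp] uV allV lexi] lt_p Ef.
have lt_f : f p < h by case: gf => f1 _ _; apply: f1.
have df : dead p.+1 f.
  move=> g gg E; have := lexi _ g gg (leqnn _) lt_p E.
  by case: gg => g1 _ _; rewrite Ef leqNgt g1.
split; last first.
  apply: leq_trans (potential_next V (ltnW lt_f)) _.
  by rewrite /potential leq_add2l [in leqRHS]big_ord_recr leq_addr.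
apply: search_next => //.
split=> //.
- split; [by lia | exact: good_le (leqnSn p) gf | by lia | move=> p0].
  by case: gf => _ f2 _; apply: f2; rewrite ?leq_pred.
- move=> k /allV[q [g [lt_q gg Ek D]]]; exists q, g; split=> //.
  case: D => [|[lt_qp D]]; first by left.
  have [lt_qp'|ge_q] := ltnP q p; first by right.
  (* The key of level [p] came from the prefix being abandoned, which is now known to be dead. *)
  have Eq : q = p by lia.
  left=> k' gk' E; apply: (df k') => // u lt_u; rewrite E ?Eq //.
  by apply: D; rewrite Eq.
- by move=> q g gg le_q lt_q; apply: lexi => //; apply: leqW.
Qed.

(** The key records the level, so an equal visited key cannot come from a shorter prefix of [f]; it
    comes from a dead map, and deadness is exchanged. *)
Lemma search_visited p f V :
  search_inv p f V -> p < n -> good p.+1 f -> skey p.+1 f (f p) \in V ->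
  dead p.+1 f.
Proof.
move=> [_ _ allV _] lt_p gf /allV[q [g [lt_q gg Ek D]]].
have f1 : f p < h by case: gf => f1 _ _; apply: f1.
have g1 : g q < h by case: gg => g1 _ _; apply: g1.
have [[Eq] Ex Eb] := skey_inj lt_p lt_q f1 g1 Ek.
subst q; case: D => [|[]]; last by rewrite ltnn.
exact: dead_exchange.
Qed.

Lemma search_push p f V :
  search_inv p f V -> p < n -> good p.+1 f -> skey p.+1 f (f p) \notin V ->
  let f' := upd f p.+1 (f p) in let V' := skey p.+1 f (f p) :: V in
  search_inv p.+1 f' V' /\ potential p.+1 f' V' < potential p f V.
Proof.
move=> inv lt_p gf nV f' V'.
have lt_f : f p < h by case: gf => f1 _ _; apply: f1.
have E u : u <= p -> f' u = f u.
  by move=> le_u; rewrite /f' upd_neq // ltn_eqF.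
have inv' : search_inv p.+1 f' V'.
  case: (inv) => -[le_p _ le_f le_fp] uV allV lexi; split.
  - split=> //; rewrite /f' ?upd_eq ?E //; first by apply: good_eq gf => u /E.
    by rewrite -/f' E.
  - by rewrite /= nV.
  - move=> k; rewrite inE => /predU1P[->|/allV[q [g [lt_q gg Ek D]]]].
      exists p, f; split=> //; right; split=> // u /E //.
    exists q, g; split=> //; case: D => [|[lt_qp D]]; [by left | right].
    split=> [|u le_u]; first by rewrite ltnW.
    by rewrite E ?D // (leq_trans le_u) // ltnW.
  - move=> q g gg le_q lt_q Eg.
    move: (le_q); rewrite leq_eqVlt => /predU1P[Eq|lt_qp]; last first.
      by rewrite E //; apply: lexi => // u lt_u; rewrite Eg // E //; lia.
    (* The new level may start at [f p], because monotonicity rules out smaller values for any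
       solution with this prefix. *)
    have Ep : g p = f p by rewrite Eg ?E // Eq.
    rewrite Eq in lt_q *; rewrite /f' upd_eq -Ep.
    by case: gg => _ g2 _; apply: g2.
split=> //; have szV := search_size inv'.
rewrite /potential [in ltnLHS]big_ord_recr /= {2}/f' upd_eq.
rewrite (eq_bigr (fun i : 'I_p.+1 => h.+1 - f i)); last first.
  by move=> i _; rewrite E // -ltnS.
rewrite /= in szV.
(* By [szV] the truncated difference really drops by one, which frees [h + 2], more than the new
   summand [h.+1 - f p]. *)
have -> : key_bound - size V = (key_bound - (size V).+1).+1 by lia.
by rewrite mulSn; lia.
Qed.

End Count.

End OrderedHom.

(** * The program *)

Definition runs (c : cmd) (s : state) (T : nat) (Q : state -> Prop) : Prop :=
  exists t s', [/\ exec c s t s', t <= T & Q s'].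

Lemma runs_weaken c s T T' (Q Q' : state -> Prop) :
  runs c s T Q -> T <= T' -> (forall s', Q s' -> Q' s') -> runs c s T' Q'.
Proof.
move=> [t [s' [X le_t q]]] le_T QQ'; exists t, s'; split=> //; last exact: QQ'.
exact: leq_trans le_T.
Qed.

Lemma runs_skip s (Q : state -> Prop) : Q s -> runs Skip s 0 Q.
Proof. by exists 0, s; split=> //; apply: ExSkip. Qed.

Lemma runs_set s r e T (Q : state -> Prop) :
  ecost s e + 2 <= T -> Q (State (upd (var s) r (eval s e)) (heap s)) ->
  runs (Set_ r e) s T Q.
Proof. by move=> le_T q; do 2 eexists; split; [apply: ExSet| |exact: q]. Qed.

Lemma runs_sto s e1 e2 T (Q : state -> Prop) :
  ecost s e1 + ecost s e2 + 3 <= T ->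
  Q (State (var s) (upd (heap s) (eval s e1) (eval s e2))) ->
  runs (Sto e1 e2) s T Q.
Proof. by move=> le_T q; do 2 eexists; split; [apply: ExSto| |exact: q]. Qed.

Lemma runs_seq s c1 c2 T1 T2 T (Q : state -> Prop) :
  T1 + T2 <= T -> runs c1 s T1 (fun s' => runs c2 s' T2 Q) ->
  runs (Seq c1 c2) s T Q.
Proof.
move=> le_T [t1 [s1 [X1 le1 [t2 [s2 [X2 le2 q]]]]]].
exists (t1 + t2), s2; split=> //; first exact: ExSeq X1 X2.
by apply: leq_trans le_T; apply: leq_add.
Qed.

Lemma runs_if s e c1 c2 T1 T (Q : state -> Prop) :
  ecost s e + 3 + T1 <= T ->
  (eval s e != 0 -> runs c1 s T1 Q) -> (eval s e = 0 -> runs c2 s T1 Q) ->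
  runs (If e c1 c2) s T Q.
Proof.
move=> le_T R1 R2; have [z|nz] := eqVneq (eval s e) 0.
  have [t [s' [X le_t q]]] := R2 z.
  by exists (ecost s e + t + 1), s'; split=> //; [apply: ExIfF | lia].
have [t [s' [X le_t q]]] := R1 nz.
by exists (ecost s e + t + 3), s'; split=> //; [apply: ExIfT | lia].
Qed.

(** The index [k] of the invariant bounds the number of remaining rounds; it may drop by more than
    one. The extra unit in [k.+1] pays for the final test. *)
Lemma runs_while (I : nat -> state -> Prop) e c Te Tb k s T (Q : state -> Prop) :
  I k s -> k.+1 * (Te + Tb + 3) <= T ->
  (forall k s, I k s -> ecost s e <= Te) ->
  (forall k s, I k s -> eval s e = 0 -> Q s) ->
  (forall k s, I k s -> eval s e != 0 ->
     runs c s Tb (fun s' => exists2 k', k' < k & I k' s')) ->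
  runs (While e c) s T Q.
Proof.
move=> Iks le_T HTe H0 H1.
suff [t [s' [X le_t q]]] : runs (While e c) s (k.+1 * (Te + Tb + 3)) Q.
  by exists t, s'; split=> //; apply: leq_trans le_T.
elim/ltn_ind: k s Iks {le_T} => k IH s Iks.
have le_e := HTe _ _ Iks.
have [z|nz] := eqVneq (eval s e) 0.
  exists (ecost s e + 1), s; split; [exact: ExWhileF | | exact: H0 Iks z].
  by rewrite mulSn; lia.
have [t1 [s1 [X1 le1 [k' lt_k' Iks1]]]] := H1 _ _ Iks nz.
have [t2 [s2 [X2 le2 q]]] := IH _ lt_k' _ Iks1.
exists (ecost s e + t1 + 3 + t2), s2; split=> //; first exact: ExWhileT X1 X2.
have : k'.+1 * (Te + Tb + 3) <= k * (Te + Tb + 3) by rewrite leq_mul2r lt_k' orbT.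
by rewrite mulSn; lia.
Qed.

(* [rS] holds n^2 + h^2 + 2, the length of the input; the cells of the input are
   copied to heap addresses S + 2, S + 3, ..., the values of the partial map are at
   2S + nreg + u, and the table of visited keys starts at 3S + nreg. *)
Notation rn := 0 (only parsing).
Notation rh := 1 (only parsing).
Notation rpack := 2 (only parsing).
Notation rS := 3 (only parsing).
Notation rp := 4 (only parsing).
Notation rx := 5 (only parsing).
Notation rrun := 6 (only parsing).
Notation rc := 7 (only parsing).
Notation ru := 8 (only parsing).
Notation rw := 9 (only parsing).
Notation rt := 10 (only parsing).
Notation rv := 11 (only parsing).
Notation rkey := 12 (only parsing).
Notation rout := 13 (only parsing).

Definition edgeG (u w : exp) : exp :=
  Ld (Plus (Plus (Var rS) (Cst 2)) (Plus (Times u (Var rn)) w)).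
Definition edgeH (a b : exp) : exp :=
  Ld (Plus (Plus (Plus (Var rS) (Cst 2)) (Times (Var rn) (Var rn)))
          (Plus (Times a (Var rh)) b)).
Definition addr_f (u : exp) : exp :=
  Plus (Plus (Plus (Var rS) (Var rS)) (Cst nreg)) u.
Definition key_base : exp :=
  Plus (Plus (Plus (Var rS) (Var rS)) (Cst nreg)) (Var rS).
Definition incr (r : nat) : cmd := Set_ r (Plus (Var r) (Cst 1)).

(** Counts in [rc] the mapped vertices that forbid target [rt] for vertex [rw]; only whether the
    count is zero matters. *)
Definition forb_cmd : cmd :=
  Seq (Set_ rc (Cst 0)) (Seq (Set_ ru (Cst 0))
    (While (Minus (Plus (Var rp) (Cst 1)) (Var ru))
      (Seq (Set_ rc (Plus (Var rc) (Times (edgeG (Var ru) (Var rw))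
              (Minus (Cst 1) (edgeH (Ld (addr_f (Var ru))) (Var rt))))))
           (incr ru)))).

Definition push_digit (d : exp) : cmd :=
  Set_ rkey (Plus (Times (Var rkey) (Plus (Plus (Var rn) (Var rh)) (Cst 2))) d).

(** Truncated subtraction supplies the maximum, as [v + (x - v)], and turns a count into a bit, as
    [1 - (1 - rc)]. *)
Definition key_row : cmd :=
  Seq (Set_ rv (Cst 0))
    (While (Minus (Var rh) (Var rv))
      (Seq (Set_ rt (Plus (Var rv) (Minus (Var rx) (Var rv))))
      (Seq forb_cmd
      (Seq (push_digit (Minus (Cst 1) (Minus (Cst 1) (Var rc))))
           (incr rv))))).

Definition key_cmd : cmd :=
  Seq (Set_ rkey key_base)
  (Seq (push_digit (Plus (Var rp) (Cst 1)))
  (Seq (push_digit (Var rx))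
  (Seq (Set_ rw (Cst 0))
    (While (Minus (Var rn) (Var rw)) (Seq key_row (incr rw)))))).

Definition search_body : cmd :=
  If (Minus (Var rn) (Var rp))
    (If (Minus (Var rh) (Var rx))
      (Seq (Sto (addr_f (Var rp)) (Var rx))
      (Seq (Set_ rw (Var rp))
      (Seq (Set_ rt (Var rx))
      (Seq forb_cmd
        (If (Var rc) (incr rx)
          (Seq key_cmd
            (If (Ld (Var rkey)) (incr rx)
              (Seq (Sto (Var rkey) (Cst 1)) (incr rp)))))))))
      (If (Var rp)
        (Seq (Set_ rp (Minus (Var rp) (Cst 1)))
             (Set_ rx (Plus (Ld (addr_f (Var rp))) (Cst 1))))
        (Seq (Set_ rout (Cst 0)) (Set_ rrun (Cst 0)))))
    (Seq (Set_ rout (Cst 1)) (Set_ rrun (Cst 0))).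

Definition search : cmd :=
  Seq (Set_ rp (Cst 0)) (Seq (Set_ rx (Cst 0)) (Seq (Set_ rrun (Cst 1))
  (Seq (While (Var rrun) search_body) (Set_ rn (Var rout))))).

(** * Correctness and running time of the program *)

Section Search.

Variables (n h : nat) (G H : rel nat).

Let S := n * n + h * h + 2.
Let X := n + h + 2.

Record layout (s : state) : Prop := Layout {
  lay_n : var s rn = n;
  lay_h : var s rh = h;
  lay_S : var s rS = S;
  lay_G : forall u w, u < n -> w < n -> heap s (S + 2 + (u * n + w)) = G u w;
  lay_H : forall a b, a < h -> b < h ->
    heap s (S + 2 + n * n + (a * h + b)) = H a b }.

Definition holds_f (p : nat) (f : nat -> nat) (s : state) : Prop :=
  forall u, u < p -> heap s (S + S + nreg + u) = f u.

Definition changes (l : seq nat) (s s' : state) : Prop :=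
  heap s' = heap s /\ forall r, r \notin l -> var s' r = var s r.

Lemma changes_layout l s s' :
  changes l s s' -> all (fun r => r \notin l) [:: rn; rh; rS] ->
  layout s -> layout s'.
Proof.
by move=> [E F] /and4P[i1 i2 i3 _] [L1 L2 L3 L4 L5]; split; rewrite ?F ?E.
Qed.

Lemma changes_trans l s1 s2 s3 : changes l s1 s2 -> changes l s2 s3 -> changes l s1 s3.
Proof.
by move=> [E1 F1] [E2 F2]; split=> [|r ir]; rewrite ?E2 ?E1 // F2 ?F1.
Qed.

Lemma changes_sub l l' s s' : {subset l <= l'} -> changes l s s' -> changes l' s s'.
Proof. by move=> sub [E F]; split=> // r nr; apply: F; apply: contra nr => /sub. Qed.

Lemma changes_set l s r v : r \in l -> changes l s (State (upd (var s) r v) (heap s)).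
Proof.
move=> rl; split=> //= r' nr'; rewrite upd_neq //.
by apply: contraNneq nr' => ->.
Qed.

(** At most [n] rounds, each linear in [X] because products by [n] and [h] are repeated additions.
    Constants here and below are generous; only the degree in [X] matters. *)
Lemma forb_cmdP s p f w v :
  layout s -> var s rp = p -> var s rw = w -> var s rt = v ->
  p < n -> w < n -> v < h -> holds_f p.+1 f s -> (forall u, u <= p -> f u < h) ->
  runs forb_cmd s (100 * X * X) (fun s' =>
    changes [:: rc; ru] s s' /\ (var s' rc != 0) = forb G H p.+1 f w v).
Proof.
move=> L Ep Ew Ev lt_p lt_w lt_v F f_h.
apply: (@runs_seq _ _ _ 3 (97 * X * X)); first by rewrite /X; nia.
apply: runs_set => //.
apply: (@runs_seq _ _ _ 3 (94 * X * X)); first by rewrite /X; nia.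
apply: runs_set => //=.
pose I k s' := exists u, [/\ u <= p.+1, k = p.+1 - u, var s' ru = u,
  changes [:: rc; ru] s s' & (var s' rc != 0) = forb G H u f w v].
apply: (@runs_while I _ _ 10 (70 * X) p.+1).
- exists 0; split=> //=.
  by apply: changes_trans; apply: changes_set.
- by rewrite /X; nia.
- by [].
- move=> _ s' [u [le_u _ Eu C Ec]] /=; rewrite Eu C.2 // Ep => z.
  by split=> //; rewrite Ec; congr (forb _ _ _ _ _ _); lia.
move=> _ s' [u [le_u -> Eu C Ec]] /=; rewrite Eu C.2 // Ep => nz.
have lt_u : u <= p by lia.
have L' := changes_layout C isT L.
have lt_un : u < n by lia.
have EG := lay_G L' lt_un lt_w; have EH := lay_H L' (f_h _ lt_u) lt_v.
have Ef : heap s' (S + S + nreg + u) = f u by rewrite C.1 F.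
have Ew' : var s' rw = w by rewrite C.2.
have Ev' : var s' rt = v by rewrite C.2.
apply: (@runs_seq _ _ _ (60 * X) (10 * X)); first by rewrite /X; nia.
apply: runs_set.
  rewrite /= (lay_n L') (lay_h L') (lay_S L') Eu Ef Ev' EH /X.
  by case: (H _ _) => /=; lia.
rewrite /= (lay_n L') (lay_h L') (lay_S L') Eu Ef Ev' Ew' EG EH.
apply: runs_set => /=; first by rewrite /X; lia.
exists (p.+1 - u.+1); first by lia.
exists u.+1; split=> //=.
- by rewrite /upd /= Eu addn1.
- by apply: changes_trans C _; apply: changes_trans; apply: changes_set.
- by rewrite /upd /= forbS -Ec addn_eq0 negb_and; case: (G _ _); case: (H _ _).
Qed.

Let hornerX := horner X.

Lemma push_digitP s d k v T (Q : state -> Prop) :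
  layout s -> var s rkey = k -> eval s d = v -> ecost s d + 5 * X + 30 <= T ->
  Q (State (upd (var s) rkey (hornerX k [:: v])) (heap s)) ->
  runs (push_digit d) s T Q.
Proof.
move=> L Ek Ed le_T q; apply: runs_set => /=.
  by apply: leq_trans le_T; rewrite (lay_n L) (lay_h L) /X; lia.
by rewrite (lay_n L) (lay_h L) Ek Ed.
Qed.

Lemma horner_rcons k l d : hornerX (hornerX k l) [:: d] = hornerX k (rcons l d).
Proof. by rewrite /hornerX /horner foldl_rcons. Qed.

Definition bit_at (p : nat) (f : nat -> nat) (wv : nat * nat) : nat :=
  forb G H p.+1 f wv.1 (maxn wv.2 (f p)).

Lemma key_rowP s p f w k :
  layout s -> var s rp = p -> var s rw = w -> var s rx = f p -> var s rkey = k ->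
  p < n -> w < n -> holds_f p.+1 f s -> (forall u, u <= p -> f u < h) ->
  runs key_row s (200 * X * X * X) (fun s' =>
    changes [:: rc; ru; rt; rv; rkey] s s' /\
    var s' rkey = hornerX k [seq bit_at p f (w, v) | v <- iota 0 h]).
Proof.
move=> L Ep Ew Ex Ek lt_p lt_w F f_h.
have lt_x := f_h p (leqnn p).
apply: (@runs_seq _ _ _ 3 (199 * X * X * X)); first by rewrite /X; nia.
apply: runs_set => //=.
pose I k' s' := exists v, [/\ v <= h, k' = h - v, var s' rv = v,
  changes [:: rc; ru; rt; rv; rkey] s s' &
  var s' rkey = hornerX k [seq bit_at p f (w, v) | v <- iota 0 v]].
apply: (@runs_while I _ _ 10 (150 * X * X) h).
- exists 0; split=> //=; first by rewrite subn0.
  exact: changes_set.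
- by rewrite /X; nia.
- by [].
- move=> _ s' [v [le_v _ Ev C Ec]] /=; rewrite Ev (C.2 rh) // (lay_h L) => z.
  by split=> //; rewrite Ec (_ : v = h) //; lia.
move=> _ s' [v [le_v -> Ev C Ec]] /=; rewrite Ev (C.2 rh) // (lay_h L) => nz.
have lt_v : v < h by lia.
apply: (@runs_seq _ _ _ 20 (140 * X * X)); first by rewrite /X; nia.
apply: runs_set => //=.
have C1 := @changes_set [:: rc; ru; rt; rv; rkey] s' rt
  (var s' rv + (var s' rx - var s' rv)) isT.
set s1 := State _ _ in C1 *.
have {}C1 := changes_trans C C1.
have L1 := changes_layout C1 isT L.
have Et : var s1 rt = maxn v (f p) by rewrite /s1 /upd /= Ev (C.2 rx) // Ex maxnE.
have Ek1 : var s1 rkey = var s' rkey by [].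
have Ev1 : var s1 rv = v by [].
apply: (@runs_seq _ _ _ (100 * X * X) (40 * X * X)); first by rewrite /X; nia.
apply: runs_weaken; first apply: (@forb_cmdP s1 p f w (maxn v (f p))) => //.
- by rewrite C1.2.
- by rewrite C1.2.
- by rewrite gtn_max lt_v lt_x.
- by move=> u lt_u; rewrite C1.1 F.
- by [].
move=> s2 [C2 Ec2].
have {}C2' : changes [:: rc; ru; rt; rv; rkey] s1 s2.
  by apply: changes_sub C2 => r; rewrite !inE => /orP[]->; rewrite ?orbT.
have C3 := changes_trans C1 C2'.
have L2 := changes_layout C3 isT L.
apply: (@runs_seq _ _ _ (30 * X) (10 * X)); first by rewrite /X; nia.
apply: push_digitP => //=; first by rewrite /X; lia.
apply: runs_set => /=; first by rewrite /X; lia.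
exists (h - v.+1); first by lia.
exists v.+1; split; [exact: lt_v | by [] | | | ].
- by rewrite /= /upd /= (C2.2 rv) // Ev1 addn1.
- by apply: changes_trans C3 _; apply: changes_trans; apply: changes_set.
- rewrite -[v.+1]addn1 iotaD map_cat cats1 -horner_rcons -Ec -Ek1 -(C2.2 rkey) //.
  rewrite /= /upd /= /bit_at -Ec2; lia.
Qed.

(** There are [n] rows of [h] digits, each digit costing a quadratic test: degree four in [X]. *)
Lemma key_cmdP s p f :
  layout s -> var s rp = p -> var s rx = f p ->
  p < n -> holds_f p.+1 f s -> (forall u, u <= p -> f u < h) ->
  runs key_cmd s (500 * X * X * X * X) (fun s' =>
    changes [:: rc; ru; rw; rt; rv; rkey] s s' /\
    var s' rkey = skey n h G H (S + S + nreg + S) p.+1 f (f p)).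
Proof.
move=> L Ep Ex lt_p F f_h.
apply: (@runs_seq _ _ _ 20 (490 * X * X * X * X)); first by rewrite /X; nia.
apply: runs_set => //=; rewrite (lay_S L).
set l := [:: rc; ru; rw; rt; rv; rkey].
set s1 := State _ _.
have C1 : changes l s s1 by apply: changes_set.
have L1 := changes_layout C1 isT L.
apply: (@runs_seq _ _ _ (30 * X) (460 * X * X * X * X)); first by rewrite /X; nia.
apply: (push_digitP L1) => //=; first by rewrite /X; lia.
set s2 := State _ _.
have C2 : changes l s s2 by apply: changes_trans C1 _; apply: changes_set.
have L2 := changes_layout C2 isT L.
apply: (@runs_seq _ _ _ (30 * X) (430 * X * X * X * X)); first by rewrite /X; nia.
apply: (push_digitP L2) => //=; first by rewrite /X; lia.
set s3 := State _ _.
have C3 : changes l s s3 by apply: changes_trans C2 _; apply: changes_set.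
have Ek : var s3 rkey = hornerX (S + S + nreg + S) [:: p.+1; f p].
  by rewrite /s3 /s2 /s1 /upd /= Ep Ex addn1.
have L3 := changes_layout C3 isT L.
move: s3 Ek C3 L3 => {s1 s2 C1 L1 C2 L2} s3 Ek C3 L3.
apply: (@runs_seq _ _ _ 3 (400 * X * X * X * X)); first by rewrite /X; nia.
apply: runs_set => //=.
pose pairs w := [seq (w, v) | w <- iota 0 w, v <- iota 0 h].
pose I k s' := exists w, [/\ w <= n, k = n - w, var s' rw = w, changes l s s' &
  var s' rkey = hornerX (S + S + nreg + S)
    (p.+1 :: f p :: [seq bit_at p f wv | wv <- pairs w])].
apply: (@runs_while I _ _ 10 (210 * X * X * X) n).
- exists 0; split=> //=; first by rewrite subn0.
  by apply: changes_trans C3 _; apply: changes_set.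
- by rewrite /X; nia.
- by [].
- move=> _ s' [w [le_w _ Ew C Ec]] /=; rewrite Ew (C.2 rn) // (lay_n L) => z.
  by split=> //; rewrite Ec (_ : w = n) //; lia.
move=> _ s' [w [le_w -> Ew C Ec]] /=; rewrite Ew (C.2 rn) // (lay_n L) => nz.
have lt_w : w < n by lia.
have L' := changes_layout C isT L.
apply: (@runs_seq _ _ _ (200 * X * X * X) 10); first by rewrite /X; nia.
apply: runs_weaken; first apply: (@key_rowP s' p f w _ L' _ Ew _ Ec) => //.
- by rewrite C.2.
- by rewrite C.2.
- by move=> u lt_u; rewrite C.1 F.
- by [].
move=> s4 [C4 E4].
have C4' : changes l s' s4.
  apply: changes_sub C4 => r; rewrite !inE.
  by do 4?[case/orP=> [->|]; rewrite ?orbT //] => ->; rewrite ?orbT.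
apply: runs_set => //=.
exists (n - w.+1); first by lia.
exists w.+1; split; [exact: lt_w | by [] | | | ].
- by rewrite /= /upd /= (C4.2 rw) // Ew addn1.
- by apply: changes_trans C _; apply: changes_trans C4' _; apply: changes_set.
- rewrite /pairs -[w.+1]addn1 iotaD allpairs_cat map_cat -!cat_cons /hornerX /horner.
  by rewrite foldl_cat /= cats0 -map_comp /upd /= E4.
Qed.

Variables (c : nat) (fib : nat -> seq nat) (tt : nat -> bool).
Hypothesis fib_size : forall x, x < h -> size (fib x) <= c.
Hypothesis fib_out : forall x a v,
  a < x -> a \notin fib x -> x <= v -> v < h -> H a v = tt x.
Hypothesis Girr : forall u, G u u = false.

Let base := S + S + nreg + S.

(** From [base] on the heap is the characteristic function of [V]. The measure is the potential plus
    one, so that stopping, with measure 0, always decreases it. *)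
Definition snapshot (k p : nat) (f : nat -> nat) (V : seq nat) (s : state) : Prop :=
  [/\ layout s, [/\ var s rrun = 1, var s rp = p & var s rx = f p],
      holds_f p f s, forall a, base <= a -> heap s a = (a \in V) &
      search_inv n h G H base p f V /\ k = (potential n h c p f V).+1].

Definition loop_inv (k : nat) (s : state) : Prop :=
  (exists p f V, snapshot k p f V s) \/
  var s rrun = 0 /\ (var s rout = 1 <-> exists g, good h G H n g).

Lemma layout_sto s a v :
  S + S <= a -> layout s -> layout (State (var s) (upd (heap s) a v)).
Proof.
move=> le_a [L1 L2 L3 L4 L5]; split=> //= i j lt_i lt_j.
  by rewrite upd_neq ?L4 //; apply/eqP; rewrite /S in le_a *; nia.
by rewrite upd_neq ?L5 //; apply/eqP; rewrite /S in le_a *; nia.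
Qed.

Lemma le_n_S : n <= S.
Proof. by rewrite /S; nia. Qed.

Lemma search_step k p f V s :
  snapshot k p f V s -> p < n -> f p < h ->
  runs (Seq (Sto (addr_f (Var rp)) (Var rx))
       (Seq (Set_ rw (Var rp))
       (Seq (Set_ rt (Var rx))
       (Seq forb_cmd
         (If (Var rc) (incr rx)
           (Seq key_cmd
             (If (Ld (Var rkey)) (incr rx)
               (Seq (Sto (Var rkey) (Cst 1)) (incr rp)))))))))
    s (900 * X * X * X * X) (fun s' => exists2 k', k' < k & loop_inv k' s').
Proof.
move=> [L [Er Ep Ex] F Vis [inv Ek]] lt_p lt_f.
have nS := le_n_S.
have [[_ gf le_f le_fp] _ _ _] := inv.
have f_h u : u <= p -> f u < h.
  by rewrite leq_eqVlt => /predU1P[->//|]; case: gf => f1 _ _; apply: f1.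
apply: (@runs_seq _ _ _ 30 (800 * X * X * X * X)); first by rewrite /X; nia.
apply: runs_sto => //=; rewrite (lay_S L) Ep Ex.
set s1 := State _ _.
have L1 : layout s1 by apply: layout_sto => //; lia.
have F1 : holds_f p.+1 f s1.
  move=> u; rewrite ltnS leq_eqVlt /s1 /= => /predU1P[->|lt_u]; first by rewrite upd_eq.
  by rewrite upd_neq ?F //; apply/eqP; lia.
have Vis1 a : base <= a -> heap s1 a = (a \in V).
  by move=> le_a; rewrite /s1 /= upd_neq ?Vis //; apply/eqP; rewrite /base in le_a; lia.
apply: (@runs_seq _ _ _ 10 (790 * X * X * X * X)); first by rewrite /X; nia.
apply: runs_set => //=.
apply: (@runs_seq _ _ _ 10 (780 * X * X * X * X)); first by rewrite /X; nia.
apply: runs_set => //=.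
set l := [:: rc; ru; rw; rt; rv; rkey].
set s2 := State _ _.
have C2 : changes l s1 s2.
  by apply: changes_trans; [apply: changes_set|apply: changes_set].
have Ew2 : var s2 rw = p by rewrite /s2 /upd.
have Et2 : var s2 rt = f p by rewrite /s2 /upd.
move: s2 C2 Ew2 Et2 => s2 C2 Ew2 Et2.
have L2 := changes_layout C2 isT L1.
apply: (@runs_seq _ _ _ (100 * X * X) (680 * X * X * X * X)); first by rewrite /X; nia.
apply: runs_weaken; first apply: (@forb_cmdP s2 p f p (f p)) => //.
- by rewrite C2.2.
- by move=> u lt_u; rewrite C2.1 F1.
- by [].
move=> s3 [C3 Ec].
have {}C3 : changes l s1 s3.
  apply: changes_trans C2 _; apply: changes_sub C3 => r.
  by rewrite !inE => /orP[]->; rewrite ?orbT.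
(* Both ways of rejecting a candidate, an edge conflict and a visited key, show the map dead and
   advance [rx]. *)
have next s' : changes l s1 s' -> dead n h G H p.+1 f ->
    runs (incr rx) s' 10 (fun s'' => exists2 k', k' < k & loop_inv k' s'').
  move=> C' df; apply: runs_set => //=.
  have lt_pot := @potential_next n h c p f V le_f.
  eexists; first by rewrite Ek ltnS; exact: lt_pot.
  left; exists p, (upd f p (f p).+1), V; split.
  - apply: (@changes_layout [:: rx] s') => //; first exact: changes_set.
    exact: changes_layout C' isT L1.
  - by split; rewrite /= /upd /= ?C'.2 // eqxx Ex addn1.
  - move=> u lt_u /=; rewrite C'.1 F1 ?upd_neq ?ltn_eqF //; exact: ltnW.
  - by move=> a le_a /=; rewrite C'.1 Vis1.
  - by split=> //; apply: search_next.
(* The loop also tests [u = p], which changes nothing as [G] has no loops. *)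
have EC : forb G H p.+1 f p (f p) = forb G H p f p (f p).
  by rewrite forbS Girr orbF.
apply: (@runs_if _ _ _ _ (600 * X * X * X * X)); first by rewrite /= /X; nia.
  rewrite /= => nz; apply: runs_weaken; first apply: next => //.
  - by apply: forb_dead => //; rewrite -EC -Ec.
  - by rewrite /X; nia.
  - by [].
rewrite /= => /eqP; rewrite -[_ == 0]negbK Ec EC => nf.
have gf1 : good h G H p.+1 f by apply: good_extend.
have L3 := changes_layout C3 isT L1.
apply: (@runs_seq _ _ _ (500 * X * X * X * X) 30); first by rewrite /X; nia.
apply: runs_weaken; first apply: (@key_cmdP s3 p f L3) => //.
- by rewrite C3.2.
- by rewrite C3.2.
- by move=> u lt_u; rewrite C3.1 F1.
- by [].
move=> s4 [C4 Ekey].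
have {}C4 := changes_trans C3 C4.
have L4 := changes_layout C4 isT L1.
set key := skey _ _ _ _ _ _ _ _ in Ekey.
(* Hence marking the key touches neither the graphs nor the stored map. *)
have le_key : base <= key by apply: horner_ge; rewrite addn2.
have Ev : heap s4 key = (key \in V) by rewrite C4.1 Vis1.
apply: (@runs_if _ _ _ _ 20) => //.
  rewrite /= Ekey Ev eqb0 negbK => kV; apply: runs_weaken; first apply: next => //.
  - by apply: search_visited kV.
  - by [].
  - by [].
rewrite /= Ekey Ev => /eqP; rewrite eqb0 => nkV.
have [inv' lt_pot] := search_push fib_size fib_out inv lt_p gf1 nkV.
apply: (@runs_seq _ _ _ 10 10) => //.
apply: runs_sto => //=; rewrite Ekey.
apply: runs_set => //=.
eexists; first by rewrite Ek ltnS; exact: lt_pot.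
left; exists p.+1, (upd f p.+1 (f p)), (key :: V); split.
- apply: (@changes_layout [:: rp] (State (var s4) (upd (heap s4) key 1))) => //.
    exact: (@changes_set _ (State _ _)).
  by apply: layout_sto => //; rewrite /base in le_key; lia.
- by split; rewrite /= /upd /= ?C4.2 //= ?eqxx ?Ep ?addn1 ?Ex.
- move=> u lt_u /=; rewrite upd_neq; last by apply/eqP; rewrite /base in le_key; lia.
  by rewrite C4.1 F1 // upd_neq // ltn_eqF.
- move=> a le_a; rewrite /= inE /upd; case: eqP => //= _.
  by rewrite C4.1 Vis1.
- by [].
Qed.

Lemma search_bodyP k s :
  loop_inv k s -> var s rrun != 0 ->
  runs search_body s (1000 * X * X * X * X)
    (fun s' => exists2 k', k' < k & loop_inv k' s').
Proof.
case=> [[p [f [V snap]]]|[-> //]] _.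
have [L [Er Ep Ex] F Vis [inv Ek]] := snap.
have [[le_p gf le_f le_fp] _ _ _] := inv.
apply: (@runs_if _ _ _ _ (990 * X * X * X * X)); rewrite /= ?(lay_n L) ?Ep.
- by rewrite /X; nia.
- move=> nz; have lt_p : p < n by lia.
  apply: (@runs_if _ _ _ _ (970 * X * X * X * X)); rewrite /= ?(lay_h L) ?Ex.
  + by rewrite /X; nia.
  + move=> nzh; have lt_f : f p < h by lia.
    apply: runs_weaken (search_step snap lt_p lt_f) _ _ => //.
    by rewrite /X; nia.
  + move=> zh; have Ef : f p = h by lia.
    apply: (@runs_if _ _ _ _ 80); rewrite /= ?Ep.
    * by rewrite /X; nia.
    * case: p F Ep snap inv le_fp Ek Ef lt_p {gf Ex le_p nz le_f zh} => //.
      move=> p F Ep snap inv le_fp Ek Ef lt_p _.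
      have [inv' lt_pot] := search_pop c inv lt_p Ef.
      apply: (@runs_seq _ _ _ 10 50) => //.
      apply: runs_set => //=; rewrite Ep subn1 /=.
      apply: runs_set => //=; rewrite /upd /= (lay_S L) F //.
      eexists; first by rewrite Ek ltnS; exact: lt_pot.
      left; exists p, (upd f p (f p).+1), V; split.
      - by case: L => L1 L2 L3 L4 L5; split.
      - by split; rewrite /= /upd /= ?Er ?eqxx ?addn1.
      - by move=> u lt_u /=; rewrite F ?upd_neq ?ltn_eqF // ltnW.
      - by [].
      - by [].
    * move=> p0; subst p.
      apply: (@runs_seq _ _ _ 10 10) => //.
      apply: runs_set => //=; apply: runs_set => //=.
      exists 0; first by rewrite Ek.
      right; split=> //=; rewrite /upd /=; split=> // -[g gg].
      rewrite p0 in inv Ef; case: (search_fail inv Ef _ gg).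
      by rewrite p0 in lt_p.
- move=> z; have Epn : p = n by lia.
  apply: (@runs_seq _ _ _ 10 10); first by rewrite /X; nia.
  apply: runs_set => //=; apply: runs_set => //=.
  exists 0; first by rewrite Ek.
  right; split=> //=; rewrite /upd /=; split=> // _.
  by exists f; rewrite -Epn.
Qed.

Lemma searchP s :
  layout s -> (forall a, base <= a -> heap s a = 0) ->
  runs search s
    ((key_bound n h c * (h + 2) + h + 4) * (1000 * X * X * X * X + 13) + 30)
    (fun s' => var s' rn = 1 <-> exists g, good h G H n g).
Proof.
move=> L Z; rewrite /search.
set T := _ * (1000 * _ * _ * _ * _ + 13).
apply: (@runs_seq _ _ _ 3 (T + 20)); first by lia.
apply: runs_set => //=.
apply: (@runs_seq _ _ _ 3 (T + 17)); first by lia.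
apply: runs_set => //=.
apply: (@runs_seq _ _ _ 3 (T + 14)); first by lia.
apply: runs_set => //=.
apply: (@runs_seq _ _ _ T 10); first by lia.
apply: (@runs_while loop_inv _ _ 10 (1000 * X * X * X * X)
          (potential n h c 0 (fun _ => 0) [::]).+1).
- left; exists 0, (fun _ => 0), [::]; split=> //.
  + by case: L => *; split.
(* The initial potential is [key_bound * (h + 2) + h.+1]. *)
- rewrite /T /potential big_ord1 subn0 /=; apply: leq_mul; lia.
- by [].
- move=> k s' [[p [f [V [_ [Er _ _] _ _ _]]]]|[_ E] _].
    by rewrite /= Er.
  by apply: runs_set => //=; rewrite /upd /=.
- exact: search_bodyP.
Qed.

End Search.

(** * Moving the input *)

(* The input fills the low addresses, which are the only ones instructions can
   name.  Address 2 holds a diagonal entry, hence 0, and is free; [pack_code]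
   saves the bits stored at addresses 3, 4, ... there as one binary number, after which
   those addresses serve as registers, and [unpack] writes the bits back
   elsewhere. *)
Fixpoint packed (inp : nat -> nat) (j : nat) : nat :=
  if j is j'.+1 then packed inp j' + inp (3 + j') * 2 ^ j' else 0.

Lemma packed_lt inp j : (forall i, inp (3 + i) <= 1) -> packed inp j < 2 ^ j.
Proof.
move=> le1; elim: j => //= j IH; rewrite expnS.
by have := le1 j; case: (inp _) => [|[]] //=; lia.
Qed.

Lemma eq_packed (f g : nat -> nat) j :
  (forall a, a != 2 -> f a = g a) -> packed f j = packed g j.
Proof. by move=> E; elim: j => //= j ->; rewrite E. Qed.

Fixpoint pack_code (j : nat) : seq instr :=
  if j is j'.+1 then IAdd 2 2 2 :: IAdd 2 2 (3 + j') :: pack_code j' else [::].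

(** Horner's rule from the highest bit down, doubling by self-addition. The code is straight-line,
    with no register spent on a loop counter. *)
Lemma pack_codeP j m :
  foldl act m (pack_code j) =1 upd m 2 (m 2 * 2 ^ j + packed m j).
Proof.
elim: j m => [|j IH] m a; first by rewrite /= muln1 addn0 /upd; case: eqP => // ->.
rewrite /=; set m' := (X in foldl _ X _); rewrite IH.
have Em' b : b != 2 -> m' b = m b by move=> nb; rewrite /m' !upd_neq.
have -> : packed m' j = packed m j.
  exact: eq_packed.
rewrite {1}/upd; case: eqP => [->|/eqP na]; last by rewrite Em' // upd_neq.
rewrite upd_eq /m' !upd_eq [upd _ _ _ (3 + j)]upd_neq // expnS; lia.
Qed.

Lemma jump_free_pack j : all jump_free (pack_code j).
Proof. by elim: j => //= j ->. Qed.

(** Bits are read off greedily from the top: [rpack + 1 - 2 ^ j'] is nonzero exactly when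
    [2 ^ j' <= rpack]. Only ones are written, as the target cells hold 0. *)
Fixpoint unpack (j : nat) : cmd :=
  if j is j'.+1 then
    Seq (If (Minus (Plus (Var rpack) (Cst 1)) (Cst (2 ^ j')))
          (Seq (Sto (Plus (Var rS) (Cst (3 + j'))) (Cst 1))
               (Set_ rpack (Minus (Var rpack) (Cst (2 ^ j')))))
          Skip)
        (unpack j')
  else Skip.

Lemma unpackP inp j s S :
  (forall i, inp (3 + i) <= 1) -> var s rS = S -> var s rpack = packed inp j ->
  (forall i, i < j -> heap s (S + (3 + i)) = 0) ->
  runs (unpack j) s (j * 50) (fun s' =>
    [/\ forall r, r != rpack -> var s' r = var s r,
        forall i, i < j -> heap s' (S + (3 + i)) = inp (3 + i) &
        forall a, (a < S + 3) || (S + (3 + j) <= a) -> heap s' a = heap s a]).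
Proof.
move=> le1; elim: j s => [|j IH] s ES Ep Z; first exact: runs_skip.
have lt_p := packed_lt j le1.
pose bit := inp (3 + j).
have le_bit : bit <= 1 by apply: le1.
rewrite /= -/bit in Ep.
apply: (@runs_seq _ _ _ 50 (j * 50)); first by rewrite mulSn.
pose Q s1 := [/\ forall r, r != rpack -> var s1 r = var s r,
  var s1 rpack = packed inp j, heap s1 (S + (3 + j)) = bit &
  forall a, a != S + (3 + j) -> heap s1 a = heap s a].
apply: (@runs_weaken _ _ 50 _ Q) => //; last first.
  move=> s1 [V1 P1 B1 H1]; apply: runs_weaken (IH s1 _ P1 _) _ _ => //.
  - by rewrite V1.
  - by move=> i lt_i; rewrite H1 ?Z ?(ltnW lt_i) //; apply/eqP; lia.
  move=> s2 [V2 B2 H2]; split=> [r nr|i|a lim].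
  - by rewrite V2 ?V1.
  - rewrite ltnS leq_eqVlt => /predU1P[->|/B2//].
    by rewrite H2 ?B1 //; apply/orP; right; lia.
  - by rewrite H2 ?H1 //; [apply/eqP | ]; lia.
have Zj := Z j (ltnSn j).
apply: (@runs_if _ _ _ _ 20) => //=; rewrite Ep.
- move=> nz; have Eb : bit = 1 by case: (bit) le_bit nz => [|[]] //; lia.
  apply: (@runs_seq _ _ _ 10 10) => //.
  apply: runs_sto => //=; apply: runs_set => //=; rewrite ES; split=> /=.
  + by move=> r nr; rewrite upd_neq.
  + by rewrite upd_eq Ep Eb; lia.
  + by rewrite upd_eq Eb.
  + by move=> a na; rewrite upd_neq.
- move=> z; have Eb : bit = 0 by case: (bit) le_bit z => [|[]] //; lia.
  apply: runs_weaken (@runs_skip s Q _) _ _ => //.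
  by split=> //; rewrite ?Eb // Ep Eb; lia.
Qed.

(** Heap cell [c] is input cell [c + nreg], so all input cells end up shifted by [rS]. Sources lie
    below [rS] and targets above it, so no source is overwritten. *)
Definition copy_cmd : cmd :=
  Seq (Set_ rc (Cst 0))
  (While (Minus (Var rS) (Var rc))
    (Seq (Sto (Plus (Plus (Var rS) (Cst nreg)) (Var rc)) (Ld (Var rc))) (incr rc))).

Lemma copyP s S :
  var s rS = S ->
  runs copy_cmd s (3 + S.+1 * 60) (fun s' =>
    [/\ forall r, r != rc -> var s' r = var s r,
        forall a, a < S -> heap s' (S + nreg + a) = heap s a &
        forall a, (a < S + nreg) || (S + nreg + S <= a) -> heap s' a = heap s a]).
Proof.
move=> ES.
apply: runs_seq; [exact: leqnn | apply: runs_set => //=].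
pose I k s' := exists c, [/\ c <= S, k = S - c, var s' rc = c,
  forall r, r != rc -> var s' r = var s r &
  [/\ forall a, a < c -> heap s' (S + nreg + a) = heap s a &
      forall a, (a < S + nreg) || (S + nreg + c <= a) -> heap s' a = heap s a]].
apply: (@runs_while I _ _ 10 40 S).
- exists 0; split=> //=; first by rewrite subn0.
  by move=> r nr; rewrite upd_neq.
- by rewrite leq_mul2l orbT.
- by [].
- move=> _ s' [c [le_c _ Ec V [C1 C2]]] /=; rewrite Ec V // ES => z.
  have Ecs : c = S by lia.
  by rewrite Ecs in C1 C2; split.
move=> _ s' [c [le_c -> Ec V [C1 C2]]] /=; rewrite Ec V // ES => nz.
have lt_c : c < S by lia.
apply: (@runs_seq _ _ _ 30 10) => //.
apply: runs_sto => //=; apply: runs_set => //=; rewrite Ec V // ES.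
exists (S - c.+1); first by lia.
exists c.+1; split=> //=; first by rewrite upd_eq addn1.
  by move=> r nr; rewrite upd_neq ?V.
have Es : heap s' c = heap s c by rewrite C2 //; apply/orP; left; lia.
split=> a lim.
  rewrite /upd eqn_add2l; case: eqP => [-> //|ne]; rewrite C1 //; lia.
by rewrite upd_neq ?C2 //; [|apply/eqP]; lia.
Qed.

Definition setup (c : cmd) : cmd :=
  Seq (Set_ rS (Plus (Plus (Times (Var rn) (Var rn)) (Times (Var rh) (Var rh))) (Cst 2)))
  (Seq (unpack (nreg - 3)) (Seq copy_cmd c)).

Lemma setupP (inp : nat -> nat) n h S s c T (Q : state -> Prop) :
  S = n * n + h * h + 2 ->
  inp 2 = 0 -> (forall i, inp (3 + i) <= 1) -> (forall a, S <= a -> inp a = 0) ->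
  var s rn = n -> var s rh = h -> var s rpack = packed inp (nreg - 3) ->
  (forall a, heap s a = inp (a + nreg)) ->
  (forall s', var s' rn = n -> var s' rh = h -> var s' rS = S ->
    (forall a, 2 <= a -> a < S -> heap s' (S + a) = inp a) ->
    (forall a, S + S + nreg <= a -> heap s' a = 0) -> runs c s' T Q) ->
  runs (setup c) s (5 * n + 5 * h + 50 + 50 * nreg + (3 + S.+1 * 60) + T) Q.
Proof.
move=> defS i2 le1 Z En Eh Ep Hs K.
have nreg3 : 3 < nreg by [].
apply: (@runs_seq _ _ _ (5 * n + 5 * h + 50) (50 * nreg + (3 + S.+1 * 60) + T)); first by lia.
apply: runs_set => /=; first by rewrite En Eh; lia.
rewrite En Eh -defS.
apply: (@runs_seq _ _ _ ((nreg - 3) * 50) (3 + S.+1 * 60 + T)); first by lia.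
set s0 := State _ _.
have Z0 i : i < nreg - 3 -> heap s0 (S + (3 + i)) = 0.
  by move=> lt_i; rewrite Hs Z //; lia.
have ES0 : var s0 rS = S by [].
have Ep0 : var s0 rpack = packed inp (nreg - 3) by exact: Ep.
apply: runs_weaken (unpackP le1 ES0 Ep0 Z0) _ _ => // s1 [V1 B1 H1].
apply: (@runs_seq _ _ _ (3 + S.+1 * 60) T); first by lia.
have ES1 : var s1 rS = S by rewrite V1.
apply: runs_weaken (copyP ES1) _ _ => // s2 [V2 C1 C2].
apply: K.
- by rewrite V2 // V1.
- by rewrite V2 // V1.
- by rewrite V2.
- move=> a le_a lt_a; have [lt_r|ge_r] := ltnP a nreg.
    rewrite C2; last by lia.
    (* Cell 2 is not among the packed ones; its target was never written and holds the right value
       0. *)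
    have [lt3|ge3] := ltnP a 3.
      have -> : a = 2 by lia.
      rewrite H1; last by lia.
      by rewrite /= Hs Z ?i2 //; lia.
    by rewrite -[a](subnKC ge3) B1 //; lia.
  rewrite -{1}[a](subnKC ge_r) addnA C1; last by lia.
  rewrite H1 /=; last by lia.
  by rewrite Hs subnK.
- move=> a le_a; rewrite C2; last by lia.
  rewrite H1 /=; last by lia.
  by rewrite Hs Z //; lia.
Qed.

Lemma cmd_ok_unpack j : cmd_ok (unpack j).
Proof. by elim: j => //= j ->. Qed.

Lemma run_compiled pre c inp s T (Q : state -> Prop) :
  all jump_free pre -> cmd_ok c -> represents s (foldl act inp pre) ->
  runs c s T Q ->
  runs_within (pre ++ compile (size pre) c) inp (size pre + T)
    (fun m => exists2 s', Q s' & m rn = var s' rn).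
Proof.
move=> jf okc R [t [s' [X le_t q]]].
set P := _ ++ _.
have : code_at P 0 P by move=> j _.
rewrite {2}/P code_at_cat add0n => -[at1 at2].
have X1 := straight_line inp at1 jf; rewrite add0n in X1.
have [m2 X2 [R1 _]] := compileP X okc at2 R.
have X12 := reach_trans X1 X2.
exists (size pre + t); split; first by rewrite leq_add2l.
(* The counter ends just past the program, where the default instruction is [IHalt]. *)
rewrite X12; split; first by rewrite /halted nth_default // size_cat.
by exists s' => //; apply: R1.
Qed.

Lemma represents_pack inp j :
  inp 2 = 0 ->
  represents (State (upd inp 2 (packed inp j)) (fun a => inp (a + nreg)))
    (foldl act inp (pack_code j)).
Proof.
move=> i2; split=> [r _|a] /=; rewrite pack_codeP i2 mul0n //.
by rewrite upd_neq //; apply/eqP; rewrite /nreg; lia.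
Qed.

(** * The encoding and the time bound *)

Definition nat_rel (k : nat) (e : rel 'I_k) : rel nat := fun i j =>
  match insub i, insub j with Some i', Some j' => e i' j' | _, _ => false end.

Lemma nat_rel_ord k (e : rel 'I_k) (i j : 'I_k) : nat_rel e i j = e i j.
Proof. by rewrite /nat_rel !valK. Qed.

Lemma adj_bitE k (e : rel 'I_k) i j :
  j < k -> adj_bit e (i * k + j) = nat_rel e i j.
Proof.
move=> lt_j; have k0 : 0 < k by apply: leq_ltn_trans lt_j.
rewrite /adj_bit /nat_rel divnMDl // divn_small // addn0 modnMDl modn_small //.
by case: insub => // a; case: insub.
Qed.

Lemma adj_bit_le1 k (e : rel 'I_k) b : adj_bit e b <= 1.
Proof. by rewrite /adj_bit; case: insub => // i; case: insub => // j; case: (e i j). Qed.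

Lemma adj_bit0 k (e : rel 'I_k) : (forall x, ~~ e x x) -> adj_bit e 0 = 0.
Proof.
move=> irr; rewrite /adj_bit div0n mod0n; case: insub => // i.
by rewrite (negbTE (irr i)).
Qed.

Section Encode.

Variables (n h : nat) (eG : rel 'I_n) (eH : rel 'I_h).
Hypotheses (sG : simple_graph eG) (sH : simple_graph eH).

Let S := n * n + h * h + 2.

Lemma encode_le1 i : encode eG eH (3 + i) <= 1.
Proof. by rewrite /encode /=; do 2 (case: ifP => _; first exact: adj_bit_le1). Qed.

Lemma encode2 : encode eG eH 2 = 0.
Proof.
rewrite /encode /=; case: ifP => _; first by apply: adj_bit0; case: sG.
(* If [n = 0], the cell is the first diagonal entry of the other matrix, or lies outside the
   input. *)
by case: ifP => // _; rewrite sub0n; apply: adj_bit0; case: sH.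
Qed.

Lemma encode_out a : S <= a -> encode eG eH a = 0.
Proof.
rewrite /S /encode => le_a.
by rewrite !ifF //; lia.
Qed.

Lemma encodeG u w : u < n -> w < n -> encode eG eH (2 + (u * n + w)) = nat_rel eG u w.
Proof.
move=> lt_u lt_w; rewrite /encode /= addKn ifT ?adj_bitE //.
by nia.
Qed.

Lemma encodeH a b :
  a < h -> b < h -> encode eG eH (2 + n * n + (a * h + b)) = nat_rel eH a b.
Proof.
move=> lt_a lt_b; rewrite /encode /=.
rewrite (_ : 2 + n * n + (a * h + b) - 2 = n * n + (a * h + b)); last by lia.
rewrite ifF; last by apply/negbTE; lia.
by rewrite addKn ifT ?adj_bitE //; nia.
Qed.

Lemma nat_rel_irr k (e : rel 'I_k) : simple_graph e -> forall u, nat_rel e u u = false.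
Proof.
move=> [_ irr] u; rewrite /nat_rel; case: insub => // i.
exact: negbTE (irr i).
Qed.

(** [good] tests edges only for [u < w]; symmetry covers the other order and irreflexivity of [eG]
    excludes [u = w]. *)
Lemma hom_ltP :
  hom_lt eG eH <-> exists g, good h (nat_rel eG) (nat_rel eH) n g.
Proof.
split=> [[f [fE fle]]|[g [g1 g2 g3]]].
  pose g u := if insub u is Some i then f i : nat else 0.
  have Eg (i : 'I_n) : g i = f i by rewrite /g valK.
  exists g; split=> [u lt_u|u v le_uv lt_v|u w lt_uw lt_w].
  - by rewrite (Eg (Ordinal lt_u)).
  - have lt_u := leq_ltn_trans le_uv lt_v.
    by rewrite (Eg (Ordinal lt_u)) (Eg (Ordinal lt_v)); apply: fle.
  - have lt_u := ltn_trans lt_uw lt_w.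
    rewrite (Eg (Ordinal lt_u)) (Eg (Ordinal lt_w)) nat_rel_ord.
    by rewrite (nat_rel_ord eG (Ordinal lt_u) (Ordinal lt_w)); apply: fE.
pose f (i : 'I_n) := Ordinal (g1 i (ltn_ord i)).
have [[symG irrG] [symH _]] := (sG, sH).
have lt_edge (u v : 'I_n) : u < v -> eG u v -> eH (f u) (f v).
  by move=> lt_uv; rewrite -!nat_rel_ord; apply: g3.
exists f; split=> [u v Euv|u v le_uv]; last exact: g2.
have [lt_uv|lt_vu|/val_inj eq_uv] := ltngtP u v; first exact: lt_edge.
  by rewrite symH lt_edge // symG.
by case/negP: (irrG v); rewrite -{1}eq_uv.
Qed.

End Encode.

(** * The smaller of A_x and B_x as the remembered set *)

Section Fibre.

Variables (h : nat) (eH : rel 'I_h).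

Definition fibre (x : nat) : seq nat :=
  map val (enum (if #|Aset eH x| <= #|Bset eH x| then Aset eH x else Bset eH x)).

Lemma fibre_size x : x < h -> size (fibre x) <= cH eH.
Proof.
move=> lt_x; rewrite size_map -cardE.
apply: leq_trans (leq_bigmax (Ordinal (leqW lt_x : x < h.+1))).
rewrite /= leq_min; case: (leqP #|Aset eH x| #|Bset eH x|) => [->|/ltnW ->].
  by rewrite leqnn.
by rewrite leqnn.
Qed.

(** Outside A_x a vertex has no neighbor from [x] on, and outside B_x no non-neighbor. With 0-based
    indices the cut at [x] puts [x] itself on the right. *)
Lemma fibre_out x a v :
  a < x -> a \notin fibre x -> x <= v -> v < h ->
  nat_rel eH a v = ~~ (#|Aset eH x| <= #|Bset eH x|).
Proof.
move=> lt_a + le_v lt_v; have lt_ah : a < h by lia.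
rewrite (nat_rel_ord eH (Ordinal lt_ah) (Ordinal lt_v)) /fibre.
set D := if _ then _ else _.
move=> na; have : Ordinal lt_ah \notin D.
  by apply: contra na => aD; apply/mapP; exists (Ordinal lt_ah); rewrite ?mem_enum.
rewrite /D; case: (leqP #|Aset eH x| #|Bset eH x|) => _;
  rewrite inE lt_a /= negb_exists => /forallP/(_ (Ordinal lt_v)).
  by rewrite /= le_v => /negbTE.
by rewrite /= le_v negbK.
Qed.

End Fibre.

(** * Estimate of the running time *)

Lemma size_pack j : size (pack_code j) = 2 * j.
Proof. by elim: j => //= j ->; lia. Qed.

Lemma addn_le_mul p q : 2 <= p -> 2 <= q -> p + q <= p * q.
Proof. by case: p => [|[|p]] //; case: q => [|[|q]] // _ _; rewrite !mulSn !mulnS; lia. Qed.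

(** With [a = n + 2] and [b = h + 2], there are at most [a ^ (2 * c + 2) * b] keys, each paying for
    [b] rounds of cost of order [(a * b) ^ 4]. The leading constant is [4 * 1013]; the rest of 4500
    absorbs the lower terms. *)
Lemma time_bound n h c :
  2 * (nreg - 3) + (5 * n + 5 * h + 50 + 50 * nreg +
    (3 + (n * n + h * h + 2).+1 * 60) +
    ((key_bound n h c * (h + 2) + h + 4) *
     (1000 * (n + h + 2) * (n + h + 2) * (n + h + 2) * (n + h + 2) + 13) + 30))
  <= 4500 * (n + 2) ^ (2 * c + 6) * (h + 2) ^ 6.
Proof.
rewrite /key_bound.
set a := n + 2; set b := h + 2.
have le_X : n + h + 2 <= a * b by rewrite /a /b; nia.
have a0 : 0 < a by rewrite /a addn2. 
have b0 : 0 < b by rewrite /b addn2.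
have le_key : n.+1 * h * n.+1 * (n.+1 * n.+1) ^ c <= a ^ (2 * c + 2) * b.
  rewrite addnC expnD expnM -!mulnn (mulnAC (a * a)) (mulnAC n.+1 h n.+1).
  apply: leq_mul; first by apply: leq_mul; rewrite /a /b; nia.
  by case: c => // c'; rewrite leq_exp2r // /a; nia.
have le_X4 : (n + h + 2) * (n + h + 2) * (n + h + 2) * (n + h + 2) <= (a * b) ^ 4.
  apply: leq_trans (_ : (n + h + 2) ^ 4 <= _); last by rewrite leq_exp2r.
  by rewrite !expnS muln1 !mulnA.
have a2 : 2 <= a by rewrite /a addn2.
have b2 : 2 <= b by rewrite /b addn2.
set Y := a * b in le_X le_X4 *.
have Y4 : 4 <= Y := leq_mul a2 b2.
have le_Y4 : 16 * (Y * Y) <= Y ^ 4.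
  by rewrite (expnM Y 2 2) -!mulnn leq_mul // (leq_mul Y4 Y4).
have le_Y2 : 5 * n + 5 * h + (n * n + h * h + 2).+1 * 60 <= 70 * (Y * Y).
  have le_YY : Y <= Y * Y by rewrite leq_pmulr // (leq_trans _ Y4).
  have le_nn : n * n + 2 <= a * a by rewrite /a; lia.
  have le_hh : h * h + 2 <= b * b by rewrite /b; lia.
  have le_sum : a * a + b * b <= Y * Y.
    rewrite mulnACA; apply: addn_le_mul.
      by apply: leq_trans a2 _; rewrite leq_pmulr.
    by apply: leq_trans b2 _; rewrite leq_pmulr.
  move: (a * a) (b * b) (Y * Y) le_nn le_hh le_sum (leq_trans le_X le_YY) => P Q R.
  by lia.
set A := a ^ (2 * c + 2) in le_key *.
have A0 : 0 < A by rewrite expn_gt0 a0.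
set K := (_ * _ ^ c) in le_key *.
have le_b : b <= A * (b * b).
  by rewrite mulnA leq_pmull // muln_gt0 A0.
have le_K : K * b + h + 4 <= 4 * (A * (b * b)).
  have le_Kb : K * b <= A * (b * b) by rewrite mulnA leq_mul2r le_key orbT.
  by rewrite /b in le_Kb le_b *; lia.
have Epow : a ^ (2 * c + 6) * b ^ 6 = A * (b * b) * Y ^ 4.
  rewrite (_ : 2 * c + 6 = (2 * c + 2) + 4); last by lia.
  rewrite (expnD a _ 4) -/A (_ : b ^ 6 = b * b * b ^ 4); last by rewrite mulnn -expnD.
  by rewrite expnMn mulnACA.
rewrite -[leqRHS]mulnA Epow.
set W := A * (b * b) in le_K *; set Z := Y ^ 4 in le_X4 le_Y4 *.
have W0 : 0 < W by rewrite !muln_gt0 A0 b0.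
have le_ZW : Z <= W * Z by rewrite leq_pmull.
set x := 1000 * _ * _ * _ * _.
have le_x : x + 13 <= 1013 * Z.
  have -> : x = 1000 * ((n + h + 2) * (n + h + 2) * (n + h + 2) * (n + h + 2)).
    by rewrite /x -!mulnA.
  by lia.
have := leq_mul le_K le_x; rewrite mulnACA.
by rewrite /nreg; lia.
Qed.

Theorem theorem4 :
  exists (P : seq instr) (C : nat),
    forall (n h : nat) (eG : rel 'I_n) (eH : rel 'I_h),
      simple_graph eG -> simple_graph eH ->
      runs_within P (encode eG eH)
        (C * (n + 2) ^ (C * (cH eH).+1) * (h + 2) ^ C)
        (fun m => m 0 = 1 <-> hom_lt eG eH).
Proof.
exists (pack_code (nreg - 3) ++ compile (size (pack_code (nreg - 3))) (setup search)).
(* The coefficient of the estimate also dominates its exponents, as [2 * c + 6 <= 4500 * c.+1]. *)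
exists 4500 => n h eG eH sG sH.
have R0 := represents_pack (nreg - 3) (encode2 sG sH).
have ok : cmd_ok (setup search).
  by rewrite /setup; cbn [cmd_ok]; rewrite cmd_ok_unpack.
have runP : runs (setup search)
  (State (upd (encode eG eH) 2 (packed (encode eG eH) (nreg - 3)))
         (fun a => encode eG eH (a + nreg)))
  (5 * n + 5 * h + 50 + 50 * nreg + (3 + (n * n + h * h + 2).+1 * 60) +
   ((key_bound n h (cH eH) * (h + 2) + h + 4) *
    (1000 * (n + h + 2) * (n + h + 2) * (n + h + 2) * (n + h + 2) + 13) + 30))
  (fun s' => var s' rn = 1 <-> exists g, good h (nat_rel eG) (nat_rel eH) n g).
  apply: (@setupP (encode eG eH) n h (n * n + h * h + 2)).
  - by [].
  - exact: encode2.
  - exact: encode_le1.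
  - exact: encode_out.
  - by rewrite /= upd_neq.
  - by rewrite /= upd_neq.
  - by rewrite /= upd_eq.
  - by [].
  move=> s' En Eh ES cells Z.
  apply: (searchP (@fibre_size _ eH) (@fibre_out _ eH) (nat_rel_irr sG)).
  - split=> // u w lt_u lt_w.
      by rewrite -addnA cells ?encodeG //; nia.
    have -> x : n * n + h * h + 2 + 2 + n * n + x =
                n * n + h * h + 2 + (2 + n * n + x) by rewrite !addnA.
    by rewrite cells ?encodeH //; nia.
  - by move=> a le_a; apply: Z; lia.
have [k [le_k [hk [s' Qs' Es']]]] := run_compiled (jump_free_pack _) ok R0 runP.
exists k; split; last by split=> //; rewrite Es' Qs' hom_ltP.
apply: leq_trans le_k _; rewrite size_pack.
apply: leq_trans (time_bound n h (cH eH)) _.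
apply: leq_mul; last by rewrite leq_pexp2l // addn2.
rewrite leq_mul2l leq_pexp2l ?orbT ?addn2 //.
by rewrite mulnS; lia.
Qed.
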